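(* Let $\mathcal{G}$ and $\mathcal{H}$ be metric graphs, with $\mathcal{G}$ not isomorphic to a circle graph. Suppose there exists a continuous map $\phi:G\to H$ with $\phi_\#\mu_G=\mu_H$ such that $h_{\mathcal{G}}(x,r)=h_{\mathcal{H}}(\phi(x),r)$ for all $x\in G$ and $r\geq0$. Then $\phi$ is an isomorphism of mm-spaces (a measure-preserving isometry).
   Context: A metric graph is a connected compact metric space $(G,d_G)$ isometric to the geometric realization of a finite one-dimensional simplicial complex with its geodesic (path-length) metric; it is regarded as the mm-space $\mathcal{G}=(G,d_G,\mu_G)$ with $\mu_G$ the uniform probability measure (one-dimensional length measure normalized to total mass one). A circle graph is a metric graph isomorphic to a circle with its intrinsic arclength distance and normalized uniform measure. The local distance distribution is $h_{\mathcal{G}}(x,r)=\mu_G(\{x'\in G: d_G(x,x')\le r\})$. *)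

(* Defs.v *)
From HB Require Import structures.
From mathcomp Require Import all_boot all_order all_algebra.
From mathcomp Require Import all_classical all_reals all_analysis.
Set Implicit Arguments. Unset Strict Implicit. Unset Printing Implicit Defensive.
Import Order.TTheory GRing.Theory Num.Theory.
Local Open Scope classical_set_scope.
Local Open Scope ring_scope.

Record mgraph (R : realType) := MGraph {
  mg_nv : nat;
  mg_ne : nat;
  mg_src : 'I_mg_ne -> 'I_mg_nv;
  mg_tgt : 'I_mg_ne -> 'I_mg_nv;
  mg_len : 'I_mg_ne -> R }.

Section MetricGraph.
Variables (R : realType) (g : mgraph R).
Local Notation nv := (mg_nv g).
Local Notation ne := (mg_ne g).
Local Notation src := (@mg_src _ g).
Local Notation tgt := (@mg_tgt _ g).
Local Notation len := (@mg_len _ g).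

Fixpoint is_walk (a b : 'I_nv) (w : seq ('I_ne * bool)) : bool :=
  match w with
  | [::] => a == b
  | (e, dir) :: w' =>
      if dir then (src e == a) && is_walk (tgt e) b w'
      else (tgt e == a) && is_walk (src e) b w'
  end.

Definition walk_len (w : seq ('I_ne * bool)) : R := \sum_(p <- w) len p.1.

(* g is the data of a finite, connected, nonempty 1-dimensional simplicial
   complex (no loops, no multiple edges) with positive edge lengths. *)
Definition is_mgraph : Prop :=
  [/\ (0 < ne)%N,
      (forall e, 0 < len e),
      (forall e, src e != tgt e),
      (forall e f, ((src e == src f) && (tgt e == tgt f))
                   || ((src e == tgt f) && (tgt e == src f)) -> e = f)
    & (forall u v : 'I_nv, exists w, is_walk u v w)].

(* points of the geometric realization: a vertex, or an interior point of an
   edge e at distance t from its source *)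
Inductive gpt := GV of 'I_nv | GE of 'I_ne & R.

Definition valid (x : gpt) : Prop :=
  match x with GV _ => True | GE e t => 0 < t < len e end.

Definition loc (x : gpt) (e : 'I_ne) (s : R) : Prop :=
  match x with
  | GV v => (v = src e /\ s = 0) \/ (v = tgt e /\ s = len e)
  | GE e' t => e' = e /\ s = t
  end.

Definition reach (x : gpt) (a : 'I_nv) (c : R) : Prop :=
  exists e s, loc x e s /\ ((a = src e /\ c = s) \/ (a = tgt e /\ c = len e - s)).

Definition path_lengths (x y : gpt) : set R :=
  [set z | (exists e s t, [/\ loc x e s, loc y e t & z = `|s - t|])
        \/ (exists a b c1 c2 w,
              [/\ reach x a c1, reach y b c2, is_walk a b w
                & z = c1 + walk_len w + c2])].

Definition gdist (x y : gpt) : R := inf (path_lengths x y).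

Definition total_len : R := \sum_(e < ne) len e.

Definition edge_slice (A : set gpt) (e : 'I_ne) : set R :=
  [set t | 0 < t < len e /\ A (GE e t)].

Definition mg_measurable (A : set gpt) : Prop :=
  forall e, measurable (edge_slice A e).

Definition mg_measure (A : set gpt) : \bar R :=
  ((\sum_(e < ne) lebesgue_measure (edge_slice A e)) * (total_len^-1)%:E)%E.

Definition hdist (x : gpt) (r : R) : \bar R :=
  mg_measure [set y | valid y /\ gdist x y <= r].

End MetricGraph.

Arguments GV {R g}.
Arguments GE {R g}.

(* circle of circumference c: points [0, c), arclength distance,
   normalized uniform measure *)
Definition circ_dist (R : realType) (c s t : R) : R :=
  Num.min `|s - t| (c - `|s - t|).

Definition circ_measure (R : realType) (c : R) (B : set R) : \bar R :=
  (lebesgue_measure (B `&` `[(0:R)%R, c[%classic) * (c^-1)%:E)%E.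

Definition is_circle_graph (R : realType) (g : mgraph R) : Prop :=
  exists c : R, 0 < c /\ exists psi : gpt g -> R,
    [/\ (forall x, valid x -> 0 <= psi x < c),
        (forall x y, valid x -> valid y -> psi x = psi y -> x = y),
        (forall s, 0 <= s < c -> exists x, valid x /\ psi x = s),
        (forall x y, valid x -> valid y -> circ_dist c (psi x) (psi y) = gdist x y)
      & (forall B : set R, measurable B ->
           mg_measure (psi @^-1` B) = circ_measure c B)].

Definition mm_iso (R : realType) (G H : mgraph R) (phi : gpt G -> gpt H) : Prop :=
  [/\ (forall x, valid x -> valid (phi x)),
      (forall x y, valid x -> valid y -> phi x = phi y -> x = y),
      (forall y, valid y -> exists x, valid x /\ phi x = y),
      (forall x y, valid x -> valid y -> gdist (phi x) (phi y) = gdist x y)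
    & (forall B, mg_measurable B -> mg_measure (phi @^-1` B) = mg_measure B)].

(* Main.v *)
(* A vertex of degree other than 2 is called a node; a connected graph without
   nodes is a circle.  For a point x put D = d(x, .).  If the ball of radius r
   around x is measured piece by piece, where the pieces are the edges and the
   two halves of the edge that contains x, one finds
     L h(x, r) = 2r + sum_v (deg v - 2) (r - D v)^+ - 2 sum_{p in Q} (r - c_p)^+
   where L is the total length, c_p is the radius at which the piece p is filled
   up from its two ends, and Q is the set of the pieces which are not the parent
   piece of a vertex in a tree of shortest paths from x.  So L h(x, r) = 2r up to
   the distance rad x from x to the nodes, and, unless x is the peak of rad on
   its edge, L h(x, r) <> 2r right after.  Hence rad_G = rad_H o phi off a null
   set, and everywhere by continuity.  As rad has slope 1 or -1 along every germ
   of an edge, phi is locally 1-Lipschitz, hence 1-Lipschitz since distances are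
   lengths of paths.  A 1-Lipschitz map that preserves the measure and the
   masses of balls is an isometry.  *)
Require Import Defs.
From HB Require Import structures.
From mathcomp Require Import all_boot all_order all_algebra.
From mathcomp Require Import all_classical all_reals all_analysis.
From mathcomp Require Import lra.
Set Implicit Arguments. Unset Strict Implicit. Unset Printing Implicit Defensive.
Import Order.TTheory GRing.Theory Num.Theory.
Import numFieldNormedType.Exports.
Local Open Scope ring_scope.

(** * Lengths of balls in rooted graphs *)

(** Peaks must be excluded: at the midpoint of an edge joining a leaf to a vertex of degree 3, one
    front dies while the other splits in two, so the growth rate is still 2 beyond [rad]. Off a
    peak, all nearest nodes are reached from x through the same end of its edge. Comparing the ball
    at x with a smaller ball inside it, whose centre is moved the other way, shows that a single
    piece is the last one on shortest paths to nearest nodes. Hence there is one nearest node, of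
    degree d say, and the rate d - 2k just beyond it equals 2 only for even d; as d <> 2, then d >=
    4, and the three or more outgoing fronts already exceed the rate 2. An edge may be longer than
    the distance between its ends, so even the distance from an interior point to an end of its own
    edge is a minimum over two routes. This is why a piece is only required to satisfy
    [|D (A p) - D (B p)| <= l p]. *)

Section PosPart.
Variable R : realFieldType.
Implicit Types (x l a b r : R).

Definition pospart x := Num.max 0 x.

Lemma pospartP x : [\/ x <= 0 /\ pospart x = 0 | 0 <= x /\ pospart x = x].
Proof.
rewrite /pospart; case: (leP x 0) => h; [left|right]; split=> //; exact: ltW.
Qed.

(* The length of the points of a piece of length l that lie within distance r of
   the root, when the ends of the piece are at distances a and b of it. *)
Definition piece_len l a b r := Num.min l (pospart (r - a) + pospart (r - b)).

Lemma piece_lenP l a b r : [\/ l <= pospart (r - a) + pospart (r - b) /\ piece_len l a b r = l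
 | pospart (r - a) + pospart (r - b) <= l /\ piece_len l a b r = pospart (r - a) + pospart (r - b)].
Proof.
rewrite /piece_len; case: (leP l) => h; [left|right]; split=> //; exact: ltW.
Qed.

Lemma piece_lenC l a b r : piece_len l a b r = piece_len l b a r.
Proof. by rewrite /piece_len addrC. Qed.

(** The fronts entering from the two ends meet at radius [(a + b + l) / 2], which the hypotheses
    place after both entries. From there on the growth of both fronts is cancelled, hence the
    doubled hinge. *)
Lemma piece_len_hinge l a b r : a <= b + l -> b <= a + l ->
  piece_len l a b r = pospart (r - a) + pospart (r - b) - pospart (r - (a + b + l) / 2) *+ 2.
Proof.
move=> h1 h2; case: (piece_lenP l a b r) => -[];
case: (pospartP (r - a)) => -[? ->]; case: (pospartP (r - b)) => -[? ->];
case: (pospartP (r - (a + b + l) / 2)) => -[? ->] ? ->; rewrite mulr2n; lra.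
Qed.

Lemma pospart_le0 x : x <= 0 -> pospart x = 0.
Proof. by move=> h; rewrite /pospart max_l. Qed.

Lemma pospart_ge0 x : 0 <= x -> pospart x = x.
Proof. by move=> h; rewrite /pospart max_r. Qed.

Lemma le_pospart x y : x <= y -> pospart x <= pospart y.
Proof. by move=> h; rewrite /pospart ge_max !le_max lexx h orbT. Qed.

Lemma piece_len_le l a b r l' a' b' r' : l <= l' -> r - a <= r' - a' -> r - b <= r' - b' ->
  piece_len l a b r <= piece_len l' a' b' r'.
Proof.
by move=> hl ha hb; rewrite /piece_len le_min !ge_min hl lerD ?le_pospart ?orbT.
Qed.

Lemma piece_len_homo l a b r r' : r <= r' -> piece_len l a b r <= piece_len l a b r'.
Proof. by move=> h; apply: piece_len_le; rewrite ?lerB. Qed.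

Lemma piece_len_tree l a r : a <= r <= a + l -> piece_len l a (a + l) r = r - a.
Proof.
move=> /andP [h1 h2]; rewrite /piece_len (@pospart_ge0 (r - a)) ?subr_ge0 //.
by rewrite (@pospart_le0 (r - (a + l))) ?subr_le0 // addr0 min_r // lerBlDl.
Qed.

(** Turns finitely many strict inequalities into one uniform gap; indices where [f] is not positive
    are ignored. *)
Lemma fin_pos_min (T : finType) (f : T -> R) :
  exists2 eps : R, 0 < eps & forall t, 0 < f t -> eps <= f t.
Proof.
suff [eps e0 H] : exists2 eps : R, 0 < eps & forall t, t \in enum T -> 0 < f t -> eps <= f t.
  by exists eps => // t; apply: H; rewrite mem_enum.
elim: (enum T) => [|t s [eps e0 H]]; first by exists 1.
case: (ltP 0 (f t)) => ft.
  exists (Num.min eps (f t)); first by rewrite lt_min e0.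
  move=> u; rewrite inE => /predU1P [-> _|us fu]; rewrite ge_min ?lexx ?orbT //.
  by rewrite H.
exists eps => // u; rewrite inE => /predU1P [-> /lt_geF|]; [by rewrite ft | exact: H].
Qed.

End PosPart.

Section Rooted.
Variables (R : realFieldType) (V P : finType) (A B : P -> V) (l : P -> R).
Variables (o : V) (D : V -> R).
Hypothesis l_gt0 : forall p, 0 < l p.
Hypothesis loopless : forall p, A p != B p.
Hypothesis Do : D o = 0.
Hypothesis D_ge0 : forall v, 0 <= D v.
Hypothesis D_lip : forall p, D (A p) <= D (B p) + l p /\ D (B p) <= D (A p) + l p.

(** The piece [p] can serve as the last piece of a shortest path from the root to [v], that is, as a
    parent piece of [v]. *)
Definition incoming v p := (A p == v) && (D v == D (B p) + l p)
  || (B p == v) && (D v == D (A p) + l p).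
Hypothesis D_inc : forall v, v != o -> exists p, incoming v p.

Definition incident v p := (A p == v) || (B p == v).
Definition degree v := #|[set p | incident v p]|.
Definition cut p : R := (D (A p) + D (B p) + l p) / 2.
Definition ball_len r := \sum_p piece_len (l p) (D (A p)) (D (B p)) r.

Lemma incoming_cut v p : incoming v p -> cut p = D v.
Proof.
by rewrite /cut => /orP [] /andP [/eqP -> /eqP ->]; lra.
Qed.

(** If a piece were a parent of both its ends, each end would be farther from the root than the
    other by [l p > 0]. *)
Lemma incoming_inj v w p : incoming v p -> incoming w p -> v = w.
Proof.
move=> /orP [] /andP [/eqP <- /eqP h] /orP [] /andP [/eqP <- /eqP h'] //;
exfalso; move: (l_gt0 p); lra.
Qed.

Lemma incoming_incident v p : incoming v p -> incident v p.
Proof. by rewrite /incident => /orP [] /andP [-> _]; rewrite ?orbT. Qed.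

Lemma ball_len_homo r r' : r <= r' -> ball_len r <= ball_len r'.
Proof. by move=> h; apply: ler_sum => p _; exact: piece_len_homo. Qed.

(** Double counting of incident pairs; without loops the two ends of a piece count for different
    vertices. *)
Lemma sum_degree (f : V -> R) :
  \sum_p (f (A p) + f (B p)) = \sum_v f v *+ degree v.
Proof.
transitivity (\sum_v \sum_(p | incident v p) f v); last first.
  by apply: eq_bigr => v _; rewrite sumr_const /degree cardsE.
rewrite (exchange_big_dep xpredT) //=; apply: eq_bigr => p _.
rewrite (bigD1 (A p)) /=; last by rewrite /incident eqxx.
rewrite (bigD1 (B p)) /=; last by rewrite /incident eqxx orbT eq_sym loopless.
rewrite big1 ?addr0 // => v /andP [/andP []].
by rewrite /incident => /orP [] /eqP <-; rewrite eqxx ?andbF.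
Qed.

Lemma ball_len_degree r :
  ball_len r = \sum_v pospart (r - D v) *+ degree v - \sum_p pospart (r - cut p) *+ 2.
Proof.
rewrite -sum_degree -sumrB; apply: eq_bigr => p _.
by case: (D_lip p) => h1 h2; rewrite piece_len_hinge.
Qed.

(* Every vertex other than the root absorbs one of the cuts, namely the one of
   a parent piece. *)
Lemma ball_len_tree : exists Q : {set P}, forall r,
  ball_len r = pospart r *+ degree o
   + \sum_(v | v != o) pospart (r - D v) * ((degree v)%:R - 2)
   - \sum_(p in Q) pospart (r - cut p) *+ 2.
Proof.
pose par v := [pick p | incoming v p].
have parP v : v != o -> exists2 p, incoming v p & par v = Some p.
  move=> /D_inc [p hp]; rewrite /par; case: pickP => [q hq|/(_ p)]; last by rewrite hp.
  by exists q.
have par_inc v p : par v == Some p -> incoming v p.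
  by rewrite /par; case: pickP => // q hq /eqP [<-].
pose Q := [set p | [forall v, (v != o) ==> (par v != Some p)]].
exists Q => r; rewrite ball_len_degree.
rewrite (bigID (mem Q) xpredT (fun p => pospart (r - cut p) *+ 2)) /=.
(* A piece outside [Q] is the chosen parent of exactly one vertex, and its cut is at the distance of
   that vertex, so these cuts can be summed over vertices. *)
have -> : \sum_(p | p \notin Q) pospart (r - cut p) *+ 2 = \sum_(v | v != o) pospart (r - D v) *+ 2.
  transitivity (\sum_(v | v != o) \sum_(p | par v == Some p) pospart (r - cut p) *+ 2); last first.
    apply: eq_bigr => v /parP [p hp pv].
    by rewrite (big_pred1 p) ?(incoming_cut hp) // => q; rewrite pv eq_sym.
  rewrite (exchange_big_dep xpredT) //= big_mkcond; apply: eq_bigr => p _.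
  rewrite inE; case: ifP => [/forallPn [v]|/negbFE /forallP H].
    rewrite negb_imply negbK => /andP [vo pv].
    rewrite (big_pred1 v) // => w /=; apply/andP/eqP => [[wo pw]|-> //].
    by apply: (incoming_inj (par_inc _ _ pw) (par_inc _ _ pv)).
  by rewrite big1 // => v /andP [vo pv]; move: (H v); rewrite vo pv.
rewrite (bigD1 o) //= Do subr0.
have -> : \sum_(v | v != o) pospart (r - D v) * ((degree v)%:R - 2) =
    \sum_(v | v != o) pospart (r - D v) *+ degree v - \sum_(v | v != o) pospart (r - D v) *+ 2.
  by rewrite -sumrB; apply: eq_bigr => v _; rewrite mulrBr !mulr_natr.
by rewrite opprD !addrA [LHS]addrAC.
Qed.

(* A cut closer than the nearest vertex of degree <> 2 would make the ball stop
   growing before it reaches that vertex. *)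
Lemma ball_len_below v0 r : degree o = 2 -> v0 != o ->
  (forall v, degree v != 2 -> D v0 <= D v) -> 0 <= r <= D v0 -> ball_len r = r *+ 2.
Proof.
move=> dego v0o hmin.
have [Q HQ] := ball_len_tree.
(* The vertex sum vanishes here: degree 2 has coefficient 0, and every other degree occurs only at
   distance at least [D v0]. *)
have E r' : 0 <= r' <= D v0 ->
    ball_len r' = r' *+ 2 - \sum_(p in Q) pospart (r' - cut p) *+ 2.
  move=> /andP [r0 rD]; rewrite HQ dego.
  rewrite [X in _ + X - _]big1 ?addr0; last first.
    move=> v _; have [->|dv] := eqVneq (degree v) 2; first by rewrite subrr mulr0.
    have := hmin v dv; case: (pospartP (r' - D v)) => -[h ->]; rewrite ?mul0r // => h2.
    by rewrite (_ : r' - D v = 0) ?mul0r //; lra.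
  by case: (pospartP r') => -[h ->] //; have -> : r' = 0 by lra.
have Qge p : p \in Q -> D v0 <= cut p.
  move=> pQ; rewrite leNgt; apply/negP => cp.
  have [q qQ qmin] : exists2 q, q \in Q & forall p', p' \in Q -> cut q <= cut p'.
    by case: (arg_minP cut pQ) => q qQ qmin; exists q.
  have cq : cut q < D v0 by apply: le_lt_trans cp; apply: qmin.
  have cq0 : 0 <= cut q.
    by rewrite /cut; move: (D_ge0 (A q)) (D_ge0 (B q)) (l_gt0 q); lra.
  have [p0 hp0] := D_inc v0o.
  pose m := Num.min (D (A p0)) (D (B p0)).
  (* From the distance [m] of its nearer end up to [D v0], the parent piece [p0] of [v0] is still
     filling, so the ball grows strictly between [r1] and [D v0]. *)
  pose r1 := Num.max (cut q) m.
  have r1D : r1 < D v0.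
    rewrite /r1 gt_max cq /= /m gt_min.
    by case/orP: hp0 => /andP [/eqP h /eqP ->]; rewrite !ltrDl !l_gt0 ?orbT.
  have r1q : cut q <= r1 by rewrite le_max lexx.
  have : ball_len r1 < ball_len (D v0).
    rewrite /ball_len [ltLHS](bigD1 p0) //= [ltRHS](bigD1 p0) //=.
    apply: ltr_leD; last by apply: ler_sum => p' _; apply: piece_len_homo; exact: ltW.
    have : m <= r1 by rewrite le_max lexx orbT.
    move: r1D; rewrite /m; clear -hp0 l_gt0.
    have lp := l_gt0 p0.
    case/orP: hp0 => /andP [/eqP <- /eqP h]; rewrite h.
    - rewrite min_r; last by lra.
      by move=> h1 h2; rewrite !(piece_lenC _ (_ + _)) !piece_len_tree; lra.
    - rewrite min_l; last by lra.
      by move=> h1 h2; rewrite !piece_len_tree; lra.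
  have L : ball_len (cut q) <= ball_len r1 by apply: ball_len_homo.
  (* By [E], the hinge of [q] alone cancels all growth beyond [cut q], where the ball has length
     exactly [2 cut q] since no cut in [Q] comes earlier. *)
  apply/negP; rewrite -leNgt; apply: le_trans L.
  rewrite !E ?cq0 ?(ltW cq) ?lexx ?D_ge0 //.
  rewrite [X in _ <= _ - X]big1; last first.
    by move=> p' /qmin h; case: (pospartP (cut q - cut p')) => -[h' ->]; lra.
  rewrite (bigD1 q) //= subr0.
  have : 0 <= \sum_(i in Q | i != q) pospart (D v0 - cut i) *+ 2.
    by apply: sumr_ge0 => i _; apply: mulrn_wge0; rewrite /pospart le_max lexx.
  case: (pospartP (D v0 - cut q)) => -[h ->]; lra.
move=> hr; rewrite E // big1 ?subr0 // => p /Qge h.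
by case: (pospartP (r - cut p)) => -[h' ->]; lra.
Qed.

(** As [p] is not a parent of [v], it is not yet full when the front arrives at [v]; that front then
    advances into it at unit speed. The room left in [p] is at least [eps], so nothing stops it
    before [D v + eps]. *)
Lemma piece_len_outgoing v p r eps : incident v p -> ~~ incoming v p ->
  (0 < l p - piece_len (l p) (D (A p)) (D (B p)) (D v) ->
    eps <= l p - piece_len (l p) (D (A p)) (D (B p)) (D v)) ->
  D v <= r <= D v + eps ->
  piece_len (l p) (D (A p)) (D (B p)) (D v) + (r - D v) <= piece_len (l p) (D (A p)) (D (B p)) r.
Proof.
have key a b k : 0 < k -> a < b + k -> (0 < k - piece_len k a b a -> eps <= k - piece_len k a b a) ->
    a <= r <= a + eps -> piece_len k a b a + (r - a) <= piece_len k a b r.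
  move=> k0 ab he /andP [r1 r2].
  have E : piece_len k a b a = pospart (a - b).
    rewrite /piece_len subrr pospart_le0 // add0r min_r //.
    by case: (pospartP (a - b)) => -[? ->]; lra.
  have he' : eps <= k - piece_len k a b a.
    by apply: he; rewrite E; case: (pospartP (a - b)) => -[? ->]; lra.
  rewrite {2}/piece_len le_min; apply/andP; split; first by lra.
  rewrite (@pospart_ge0 _ (r - a)) ?subr_ge0 // E addrC lerD2l le_pospart //; lra.
rewrite /incident /incoming negb_or !negb_and => ipv /andP [nA nB] he hr.
move: (l_gt0 p) (D_lip p) => lp [lip1 lip2].
case/orP: ipv => /eqP E.
  rewrite -E in he hr *; apply: key => //.
  by move: nA; rewrite E eqxx /= -E lt_neqAle => ->.
rewrite -E in he hr *; rewrite !(piece_lenC _ (D (A p))) in he *.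
apply: key => //.
by move: nB; rewrite E eqxx /= -E lt_neqAle => ->.
Qed.

(* Just beyond the nearest vertex of degree d <> 2 the ball grows at the rate
   d - 2k, where k counts the pieces whose two ends are closed up there.  This
   is not 2 if d is odd; and the d - 1 pieces leaving that vertex force a rate
   of at least d - 1. *)
Lemma ball_len_beyond v1 p1 eta : degree o = 2 -> v1 != o -> degree v1 != 2 ->
  (forall v, degree v != 2 -> D v1 <= D v) -> incoming v1 p1 ->
  (forall v p, degree v != 2 -> D v = D v1 -> incoming v p -> p = p1) ->
  0 < eta -> exists2 r, D v1 < r < D v1 + eta & ball_len r != r *+ 2.
Proof.
move=> dego v1o dv1 hmin inc1 uniq1 eta0.
(* Two nearest nodes would share the parent piece [p1], which is a parent of one vertex only. *)
have uniqv v : degree v != 2 -> D v = D v1 -> v = v1.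
  move=> dv Dv; have vo : v != o by apply: contraNneq dv => ->; rewrite dego.
  have [p hp] := D_inc vo; have E := uniq1 v p dv Dv hp.
  by apply: incoming_inj inc1; rewrite -E.
have [e1 e10 he1] := fin_pos_min (fun v => D v - D v1).
have [e2 e20 he2] := fin_pos_min (fun p => cut p - D v1).
have [e3 e30 he3] := fin_pos_min (fun p => l p - piece_len (l p) (D (A p)) (D (B p)) (D v1)).
(* Strictly between [D v1] and [D v1 + e] there is no vertex distance and no cut, and every piece
   not full at [D v1] still has room at least [e]. *)
pose e := Num.min (Num.min e1 e2) (Num.min e3 eta).
have [e_e1 e_e2 e_e3 e_eta] : [/\ e <= e1, e <= e2, e <= e3 & e <= eta].
  by rewrite /e !ge_min !lexx !orbT.
have e0 : 0 < e by rewrite /e !lt_min e10 e20 e30 eta0.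
have {he1} he1 v : D v1 < D v -> D v1 + e <= D v.
  by move=> h; have := he1 v; rewrite subr_gt0 => /(_ h); lra.
have {he2} he2 p : D v1 < cut p -> D v1 + e <= cut p.
  by move=> h; have := he2 p; rewrite subr_gt0 => /(_ h); lra.
pose r := D v1 + e / 2; exists r; first by rewrite /r; lra.
apply/eqP => Er.
have ER : ball_len (D v1) = D v1 *+ 2.
  by apply: (ball_len_below (v0 := v1)) => //; rewrite D_ge0 lexx.
have [Q HQ] := ball_len_tree.
have Qge p : p \in Q -> D v1 <= cut p.
  move=> pQ; rewrite leNgt; apply/negP => cp.
  move: (HQ (D v1)); rewrite dego pospart_ge0 // big1 ?addr0; last first.
    move=> v _; have [->|dv] := eqVneq (degree v) 2; first by rewrite subrr mulr0.
    by rewrite pospart_le0 ?mul0r // subr_le0 hmin.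
  rewrite ER (bigD1 p) //=.
  have : 0 <= \sum_(i in Q | i != p) pospart (D v1 - cut i) *+ 2.
    by apply: sumr_ge0 => i _; apply: mulrn_wge0; rewrite /pospart le_max lexx.
  by rewrite (@pospart_ge0 _ (_ - cut p)) ?subr_ge0 ?(ltW cp) //; lra.
pose k := #|[pred p in Q | cut p == D v1]|.
have rR : r - D v1 = e / 2 by rewrite /r addrC addKr.
(* At [r] only [v1] and the [k] cuts located at [D v1] contribute, so the assumption
   [ball_len r = 2 r] becomes [(e / 2) (degree v1 - 2) = k e]. *)
have Hk : ((degree v1)%:R - 2 - k%:R * 2 : R) = 0.
  move: (HQ r); rewrite dego pospart_ge0; last by rewrite /r; move: (D_ge0 v1); lra.
  rewrite (bigD1 v1) //= [X in _ + (_ + X)]big1 ?addr0; last first.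
    move=> v /andP [_ vv1]; have [->|dv] := eqVneq (degree v) 2; first by rewrite subrr mulr0.
    rewrite pospart_le0 ?mul0r //; have := hmin v dv; rewrite le_eqVlt => /predU1P [E|/he1].
      by move: vv1; rewrite (uniqv v) ?eqxx.
    by rewrite /r; lra.
  rewrite (bigID (fun p => cut p == D v1)) /= [X in _ - (_ + X)]big1 ?addr0; last first.
    move=> p /andP [/Qge]; rewrite le_eqVlt eq_sym => /orP [->//|/he2 h _].
    by rewrite pospart_le0 ?mul0rn // /r; lra.
  rewrite (eq_bigr (fun=> e)); last first.
    move=> p /andP [_ /eqP ->]; rewrite rR pospart_ge0; lra.
  rewrite sumr_const -/k Er rR pospart_ge0; last by lra.
  rewrite -mulr_natl => H.
  have : e * ((degree v1)%:R - 2 - k%:R * 2) = 0 by lra.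
  by move=> /eqP; rewrite mulf_eq0 gt_eqF //= => /eqP.
have degk : degree v1 = (2 + k * 2)%N.
  by apply/eqP; rewrite -(eqr_nat R) natrD natrM; apply/eqP; move: Hk; lra.
have deg4 : (4 <= degree v1)%N by move: dv1; rewrite degk; case: (k).
have out p : p \in [set p | incident v1 p] :\ p1 ->
    e / 2 <= piece_len (l p) (D (A p)) (D (B p)) r - piece_len (l p) (D (A p)) (D (B p)) (D v1).
  rewrite !inE => /andP [pp1 pi]; rewrite lerBrDl -rR.
  apply: (@piece_len_outgoing v1 p r e3) => //; first last.
  - by rewrite /r; lra.
  - exact: (he3 p).
  by apply: contra pp1 => /(uniq1 v1 p dv1 erefl) ->.
have : ball_len r - ball_len (D v1) = e by rewrite Er ER /r; lra.
rewrite /ball_len -sumrB (bigID (mem ([set p | incident v1 p] :\ p1))) /=.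
set S1 := \sum_(i | _) _; set S2 := \sum_(i | _) _ => HS.
have S2ge : 0 <= S2.
  by apply: sumr_ge0 => p _; rewrite subr_ge0 piece_len_homo // /r; lra.
(* At least three pieces other than [p1] leave [v1] and gain [e / 2] each, against a total gain of
   [e]. *)
have : e / 2 *+ 3 <= S1.
  apply: (@le_trans _ _ (\sum_(p in [set p | incident v1 p] :\ p1) (e / 2))); last exact: ler_sum.
  rewrite sumr_const; apply: ler_wpMn2l; first by lra.
  move: deg4; rewrite /degree (cardsD1 p1) inE incoming_incident //.
lra.
Qed.

End Rooted.

(** * Balls around a point inside an edge *)

Lemma big_option (T : Type) (idx : T) (op : Monoid.com_law idx) (E : finType) (F : option E -> T) :
  \big[op/idx]_p F p = op (F None) (\big[op/idx]_e F (Some e)).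
Proof.
rewrite (bigD1 None) //=; congr (op _ _).
rewrite (reindex_omap Some id) /=; last by case.
by apply: eq_bigl => e; rewrite eqxx.
Qed.

Section Subdivision.
Variables (R : realFieldType) (V E : finType) (src tgt : E -> V) (len : E -> R).
Variable d : V -> V -> R.
Hypothesis len_gt0 : forall e, 0 < len e.
Hypothesis loopless : forall e, src e != tgt e.
Hypothesis d_ge0 : forall u v, 0 <= d u v.
Hypothesis dxx : forall u, d u u = 0.
Hypothesis d_lip : forall u e, d u (src e) <= d u (tgt e) + len e /\ d u (tgt e) <= d u (src e) + len e.
Hypothesis d_inc : forall u v, v != u -> exists e, incoming src tgt len (d u) v e.

Variable e0 : E.
Implicit Types (s r : R) (p : option E) (v : V).

(** The two routes from the point at distance [s] from the source of [e0] leave through either end.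
    For [v = src e0] the minimum need not be [s], since [e0] may be longer than a detour. *)
Definition pt_dist s v := Num.min (s + d (src e0) v) (len e0 - s + d (tgt e0) v).

Definition pt_ball_len s r :=
  \sum_(e | e != e0) piece_len (len e) (pt_dist s (src e)) (pt_dist s (tgt e)) r
  + piece_len s (pt_dist s (src e0)) 0 r + piece_len (len e0 - s) 0 (pt_dist s (tgt e0)) r.

(* The graph with the edge e0 cut at distance s of its source: the vertex None
   is the cut point, Some e0 and None are the two halves of e0. *)
Let sA p := if p is Some e then Some (src e) else None.
Let sB p := if p is Some e then if e == e0 then None else Some (tgt e) else Some (tgt e0).
Let sl s p := if p is Some e then if e == e0 then s else len e else len e0 - s.
Let sD s (w : option V) : R := oapp (pt_dist s) 0 w.

Lemma pt_ball_lenE s r : pt_ball_len s r = ball_len sA sB (sl s) (sD s) r.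
Proof.
rewrite /pt_ball_len /ball_len big_option /= [RHS]addrC; congr (_ + _).
rewrite [in RHS](bigD1 e0) //= eqxx /= [RHS]addrC; congr (_ + _).
by apply: eq_bigr => e /negbTE ->.
Qed.

Lemma degree_sub v : degree sA sB (Some v) = degree src tgt v.
Proof.
rewrite /degree !cardsE -!sum1_card [LHS]big_mkcond [RHS]big_mkcond /= big_option /=.
rewrite (bigD1 e0) //= [in RHS](bigD1 e0) //= addnA; congr (_ + _)%N.
  rewrite !unfold_in /incident /= eqxx orbF /= !(inj_eq Some_inj) -/(incident src tgt v e0).
  have := loopless e0; rewrite /incident.
  case: (src e0 =P v) => [->|_]; last by case: (tgt e0 == v).
  by rewrite eq_sym => /negbTE ->.
by apply: eq_bigr => e /negbTE ee0; rewrite !unfold_in /incident /= ee0 !(inj_eq Some_inj).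
Qed.

Lemma degree_root : degree sA sB None = 2.
Proof.
rewrite /degree; have -> : [set p | incident sA sB None p] = [set None; Some e0].
  apply/setP => -[e|]; rewrite !inE /incident //=.
  by rewrite -[RHS]/(e == e0); case: (e == e0).
exact: (cards2 None (Some e0)).
Qed.

Section Fixed.
Variable s : R.
Hypothesis hs : 0 < s < len e0.

Lemma sl_gt0 p : 0 < sl s p.
Proof. by case: p => [e|] /=; [case: ifP|]; rewrite ?len_gt0 //; move: hs; lra. Qed.

Lemma sub_loopless p : sA p != sB p.
Proof. by case: p => [e|] //; rewrite /sA /sB; case: ifP => // _; rewrite (inj_eq Some_inj) loopless. Qed. 

Lemma pt_distP v : [\/ pt_dist s v = s + d (src e0) v /\ pt_dist s v <= len e0 - s + d (tgt e0) v
  | pt_dist s v = len e0 - s + d (tgt e0) v /\ pt_dist s v <= s + d (src e0) v].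
Proof. by rewrite /pt_dist; case: (leP (s + d (src e0) v)) => h; [left|right]; split=> //; apply: ltW. Qed.

Lemma pt_dist_gt0 v : 0 < pt_dist s v.
Proof. by move: (d_ge0 (src e0) v) (d_ge0 (tgt e0) v) hs; case: (pt_distP v) => -[-> _]; lra. Qed.

Lemma sD_ge0 w : 0 <= sD s w.
Proof. by case: w => //= v; apply/ltW/pt_dist_gt0. Qed.

Lemma pt_dist_lip e : pt_dist s (src e) <= pt_dist s (tgt e) + len e /\ pt_dist s (tgt e) <= pt_dist s (src e) + len e.
Proof.
move: (d_lip (src e0) e) (d_lip (tgt e0) e) => [? ?] [? ?].
by case: (pt_distP (src e)) => -[? ?]; case: (pt_distP (tgt e)) => -[? ?]; lra.
Qed.

Lemma sD_lip p : sD s (sA p) <= sD s (sB p) + sl s p /\ sD s (sB p) <= sD s (sA p) + sl s p.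
Proof.
case: p => [e|] /=; last first.
  move: (pt_dist_gt0 (tgt e0)) hs => ? ?; split; first by lra.
  by case: (pt_distP (tgt e0)); rewrite dxx => -[? ?]; lra.
case: ifP => [/eqP ->|_] /=; last exact: pt_dist_lip.
move: (pt_dist_gt0 (src e0)) hs => ? ?; split; last by lra.
by case: (pt_distP (src e0)); rewrite dxx => -[? ?]; lra.
Qed.

(** A shortest route to [v] leaves the cut point through one end of [e0]. If [v] is that end, the
    half edge is a parent; otherwise the last edge of a shortest path from that end to [v] is one.
    That edge is not [e0], since running back along [e0] would be longer than going straight to its
    other end. *)
Lemma sD_inc w : w != None -> exists p, incoming sA sB (sl s) (sD s) w p.
Proof.
case: w => // v _; move: (pt_dist_lip e0) => [lip1 lip2].
have other u x : pt_dist s v = x + d u v -> (forall w, pt_dist s w <= x + d u w) ->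
    v != u -> (incoming src tgt len (d u) v e0 -> False) ->
    exists p, incoming sA sB (sl s) (sD s) (Some v) p.
  move=> Edv le vu ne0; have [e he] := d_inc vu; exists (Some e).
  have ee0 : e == e0 = false by apply/eqP => h; apply: ne0; rewrite -h.
  have [l1 l2] := pt_dist_lip e.
  rewrite /incoming /= ee0 /= !(inj_eq Some_inj).
  case/orP: he => /andP [/eqP Ev /eqP h]; rewrite -Ev in Edv h *; rewrite eqxx /=.
    by apply/orP; left; apply/eqP; move: (le (tgt e)); lra.
  by apply/orP; right; apply/eqP; move: (le (src e)); lra.
case: (pt_distP v) => -[Edv le].
  case: (eqVneq v (src e0)) => [vs|vs].
    by exists (Some e0); rewrite /incoming /= eqxx /= vs eqxx /= add0r -vs Edv vs dxx addr0 eqxx.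
  apply: (other _ _ Edv) => // [w|]; first by rewrite /pt_dist ge_min lexx.
  rewrite /incoming => /orP [] /andP [/eqP Ev /eqP h]; first by rewrite Ev eqxx in vs.
  by move: Edv le h; rewrite -Ev !dxx; move: hs; lra.
case: (eqVneq v (tgt e0)) => [vs|vs].
  by exists None; rewrite /incoming /= vs eqxx /= add0r -vs Edv vs dxx addr0 eqxx.
apply: (other _ _ Edv) => // [w|]; first by rewrite /pt_dist ge_min lexx orbT.
rewrite /incoming => /orP [] /andP [/eqP Ev /eqP h]; last by rewrite Ev eqxx in vs.
by move: Edv le h; rewrite -Ev !dxx; move: hs; lra.
Qed.

Lemma pt_ball_len_below v0 r : degree src tgt v0 != 2 ->
  (forall v, degree src tgt v != 2 -> pt_dist s v0 <= pt_dist s v) ->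
  0 <= r <= pt_dist s v0 -> pt_ball_len s r = r *+ 2.
Proof.
move=> dv0 hmin hr; rewrite pt_ball_lenE.
apply: (ball_len_below sl_gt0 sub_loopless (erefl : sD s None = 0) sD_ge0 sD_lip sD_inc
  (v0 := Some v0)) => //; first exact: degree_root.
by case=> [v|]; rewrite ?degree_root // degree_sub => /hmin.
Qed.

End Fixed.

(* Moving the centre away from the nearest vertices by delta loses 2 delta of
   length on every piece through which such a vertex is reached, but only
   2 delta altogether: there is a single such piece. *)
Lemma pt_ball_len_beyond s v0 eta : 0 < s < len e0 -> degree src tgt v0 != 2 ->
  (forall v, degree src tgt v != 2 -> pt_dist s v0 <= pt_dist s v) ->
  (forall v, degree src tgt v != 2 -> pt_dist s v0 < s + d (src e0) v) ->
  0 < eta -> exists2 r, pt_dist s v0 < r < pt_dist s v0 + eta & pt_ball_len s r != r *+ 2.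
Proof.
move=> hs dv0 hmin hstrict eta0.
have v0N : Some v0 != None by [].
have [p1 inc1] := sD_inc hs v0N.
have [r hr hne] : exists2 r, sD s (Some v0) < r < sD s (Some v0) + eta
    & ball_len sA sB (sl s) (sD s) r != r *+ 2; last first.
  by exists r => //; rewrite pt_ball_lenE.
apply: (ball_len_beyond (sl_gt0 hs) sub_loopless (erefl : sD s None = 0) (sD_ge0 hs) (sD_lip hs)
  (sD_inc hs) degree_root v0N _ _ inc1) => //.
- by rewrite degree_sub.
- by case=> [v|]; rewrite ?degree_root // degree_sub => /hmin.
case=> [v|] p2; rewrite ?degree_root // degree_sub => dv Dv inc2.
have R0 := pt_dist_gt0 hs v0; have [Rd ERd] : exists y, y = pt_dist s v0 by exists (pt_dist s v0).
rewrite /= -ERd in R0 Dv hmin hstrict.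
have [eps1 eps10 he1] := fin_pos_min len.
have [eps2 eps20 he2] := fin_pos_min (fun v => s + d (src e0) v - Rd).
(* With [dl = x / 2], a missed segment of length [2 dl] fits into any edge, routes to nodes through
   the source have slack at least [2 dl], the smaller ball reaches back to the old centre, and the
   new centre stays inside [e0]. *)
pose x := Num.min (Num.min eps1 eps2) (Num.min Rd s).
have x0 : 0 < x.
  have gen (u v' w z : R) : 0 < u -> 0 < v' -> 0 < w -> 0 < z -> 0 < Num.min (Num.min u v') (Num.min w z).
    by move=> u0 v0' w0 z0; rewrite !lt_min u0 v0' w0.
  by apply: gen => //; case/andP: hs.
have [x1 x2 x3 x4] : [/\ x <= eps1, x <= eps2, x <= Rd & x <= s].
  by rewrite /x !ge_min !lexx !orbT.
pose dl := x / 2; have dl0 : 0 < dl by rewrite /dl; lra.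
have hs' : 0 < s - dl < len e0 by move: hs; rewrite /dl; lra.
have lenx e : dl *+ 2 <= len e by move: (he1 e (len_gt0 e)); rewrite /dl; lra.
have D'ge w : pt_dist s w <= pt_dist (s - dl) w + dl.
  by move: (pt_distP s w) (pt_distP (s - dl) w) => [] [? ?] [] [? ?]; lra.
(* Routes through the target become longer by [dl]; those through the source become shorter by [dl]
   but had slack [2 dl]. *)
have D'node w : degree src tgt w != 2 -> Rd + dl <= pt_dist (s - dl) w.
  move=> dw; have := he2 w; rewrite subr_gt0 => /(_ (hstrict w dw)).
  move: (hmin w dw) (hstrict w dw); rewrite /dl.
  by move: (pt_distP s w) (pt_distP (s - dl) w); rewrite /dl => [] [] [? ?] [] [? ?]; lra.
have D'eq w : degree src tgt w != 2 -> pt_dist s w = Rd -> pt_dist (s - dl) w = Rd + dl.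
  move=> dw Ew; apply/eqP; rewrite eq_le D'node // andbT.
  move: (hstrict w dw).
  by move: (pt_distP s w) (pt_distP (s - dl) w) => [] [? ?] [] [? ?]; lra.
have D'v0 := D'eq v0 dv0 (esym ERd).
pose f p := piece_len (sl s p) (sD s (sA p)) (sD s (sB p)) Rd.
pose g p := piece_len (sl (s - dl) p) (sD (s - dl) (sA p)) (sD (s - dl) (sB p)) (Rd - dl).
(* The segment between the two centres lies in both balls; [f] counts it in the half [Some e0], [g]
   in the half [None], and [a] discards it from both counts. *)
pose a p := if p is Some e then if e == e0 then - dl else 0 else dl.
have Ef : \sum_p f p = Rd *+ 2.
  rewrite -[LHS]/(ball_len _ _ _ _ _) -pt_ball_lenE; apply: (pt_ball_len_below hs dv0); rewrite -ERd //.
  by rewrite lexx ltW.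
have Eg : \sum_p g p = (Rd - dl) *+ 2.
  rewrite -[LHS]/(ball_len _ _ _ _ _) -pt_ball_lenE; apply: (pt_ball_len_below hs' dv0).
    by move=> w /D'node; rewrite D'v0.
  by rewrite D'v0 /dl; lra.
have Ea : \sum_p a p = 0.
  rewrite big_option (bigD1 e0) //= eqxx big1 ?addr0 ?subrr // => e /negbTE /= ->.
  by [].
(* The ball of radius [Rd - dl] around the moved centre lies in the ball of radius [Rd] around the
   old one. *)
have h0 p : 0 <= f p - g p + a p.
  rewrite /f /g /a; case: p => [e|] /=; last first.
    rewrite addrAC subr_ge0 /piece_len /=.
    move: (D'ge (tgt e0)) => ?.
    case: (leP (len e0 - s)) => ?; rewrite ge_min; apply/orP.
      by left; lra.
    right; rewrite !subr0 (pospart_ge0 (ltW R0)) (@pospart_ge0 _ (Rd - dl)); last by rewrite /dl; lra.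
    have := @le_pospart R (Rd - dl - pt_dist (s - dl) (tgt e0)) (Rd - pt_dist s (tgt e0)); lra.
  case: ifP => [/eqP ->|_] /=; last first.
    by rewrite addr0 subr_ge0 piece_len_le //; move: (D'ge (src e)) (D'ge (tgt e)); lra.
  rewrite addrAC subr_ge0 lerBrDr /piece_len.
  move: (D'ge (src e0)) => ?.
  case: (leP s) => ?.
    by rewrite -lerBrDr ge_min lexx.
  rewrite -lerBrDr ge_min; apply/orP; right.
  rewrite !subr0 (pospart_ge0 (ltW R0)) (@pospart_ge0 _ (Rd - dl)); last by rewrite /dl; lra.
  have := @le_pospart R (Rd - dl - pt_dist (s - dl) (src e0)) (Rd - pt_dist s (src e0)); lra.
(* A parent piece of a nearest node [w] is full in the first ball. In the second, [w] is at distance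
   [Rd + dl] while the radius is [Rd - dl], so a segment of length at least [2 dl] next to [w] is
   missed. *)
have h2 w p : degree src tgt w != 2 -> pt_dist s w = Rd ->
    incoming sA sB (sl s) (sD s) (Some w) p -> dl *+ 2 <= f p - g p + a p.
  move=> dw Ew; have E'w := D'eq w dw Ew.
  rewrite /incoming /f /g /a; case: p => [e|] /=; last first.
    rewrite !(inj_eq Some_inj) => /andP [/eqP Ew2 /eqP]; rewrite Ew2 add0r Ew E'w => ER.
    rewrite -ER /piece_len subr0 subrr (@pospart_le0 _ 0) // addr0 pospart_ge0 ?(ltW R0) //.
    rewrite minxx subr0 (@pospart_ge0 _ (Rd - dl)); last by rewrite /dl; lra.
    rewrite pospart_le0; last by lra.
    rewrite addr0 min_r; lra.
  case: ifP => [/eqP ->|_] /=; rewrite !(inj_eq Some_inj).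
    rewrite orbF => /andP [/eqP Ew2 /eqP]; rewrite Ew2 Ew add0r => ER.
    by have := hstrict w dw; rewrite -Ew2 dxx addr0 ER ltxx.
  have [l1 l2] := pt_dist_lip (s - dl) e; have lx := lenx e; have lp := len_gt0 e.
  case/orP => /andP [/eqP Ew2 /eqP]; rewrite Ew2 Ew in l1 l2 *; rewrite E'w => ED; rewrite addr0.
    rewrite E'w in l1; rewrite /piece_len subrr (@pospart_le0 _ 0) // add0r.
    rewrite (@pospart_ge0 _ (Rd - pt_dist s (tgt e))); last by lra.
    rewrite (@pospart_le0 _ (Rd - dl - (Rd + dl))); last by lra.
    rewrite add0r min_l; last by lra.
    case: (pospartP (Rd - dl - pt_dist (s - dl) (tgt e))) => -[? ->].
      have : Num.min (len e) 0 <= 0 by rewrite ge_min lexx orbT.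
      lra.
    have : Num.min (len e) (Rd - dl - pt_dist (s - dl) (tgt e)) <= Rd - dl - pt_dist (s - dl) (tgt e).
      by rewrite ge_min lexx orbT.
    lra.
  rewrite E'w in l2; rewrite /piece_len subrr (@pospart_le0 _ 0) // addr0.
  rewrite (@pospart_ge0 _ (Rd - pt_dist s (src e))); last by lra.
  rewrite (@pospart_le0 _ (Rd - dl - (Rd + dl))); last by lra.
  rewrite addr0 min_l; last by lra.
  case: (pospartP (Rd - dl - pt_dist (s - dl) (src e))) => -[? ->].
    have : Num.min (len e) 0 <= 0 by rewrite ge_min lexx orbT.
    lra.
  have : Num.min (len e) (Rd - dl - pt_dist (s - dl) (src e)) <= Rd - dl - pt_dist (s - dl) (src e).
    by rewrite ge_min lexx orbT.
  lra.
have Eh : \sum_p (f p - g p + a p) = dl *+ 2.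
  rewrite big_split sumrB /= Ef Eg Ea; lra.
apply/eqP; apply: contraT => p12; exfalso.
move: Eh; rewrite (bigD1 p1) //= (bigD1 p2) //=.
have := h2 _ _ dv0 (esym ERd) inc1; have := h2 _ _ dv Dv inc2.
have : 0 <= \sum_(p | (p != p1) && (p != p2)) (f p - g p + a p) by apply: sumr_ge0 => p _; exact: h0.
lra.
Qed.

End Subdivision.

Section Reversal.
Variables (R : realFieldType) (V E : finType) (src tgt : E -> V) (len : E -> R).
Variable d : V -> V -> R.

Lemma degreeC v : degree src tgt v = degree tgt src v.
Proof. by apply: eq_card => p; rewrite !inE /incident orbC. Qed.

Lemma incomingC (D : V -> R) v p : incoming src tgt len D v p = incoming tgt src len D v p.
Proof. by rewrite /incoming orbC. Qed.

Lemma pt_distC e0 s v : pt_dist src tgt len d e0 s v = pt_dist tgt src len d e0 (len e0 - s) v.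
Proof. by rewrite /pt_dist minC subKr. Qed.

Lemma pt_ball_lenC e0 s r :
  pt_ball_len src tgt len d e0 s r = pt_ball_len tgt src len d e0 (len e0 - s) r.
Proof.
rewrite /pt_ball_len subKr addrAC -!pt_distC; congr (_ + _ + _); rewrite 1?piece_lenC //.
by apply: eq_bigr => e _; rewrite piece_lenC -!pt_distC.
Qed.

Hypothesis len_gt0 : forall e, 0 < len e.
Hypothesis loopless : forall e, src e != tgt e.
Hypothesis d_ge0 : forall u v, 0 <= d u v.
Hypothesis dxx : forall u, d u u = 0.
Hypothesis d_lip : forall u e, d u (src e) <= d u (tgt e) + len e /\ d u (tgt e) <= d u (src e) + len e.
Hypothesis d_inc : forall u v, v != u -> exists e, incoming src tgt len (d u) v e.

(** The second alternative becomes the first when all edges are reversed, which replaces [s] by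
    [len e0 - s]. *)
Lemma pt_ball_len_off_peak e0 s v0 eta : 0 < s < len e0 -> degree src tgt v0 != 2 ->
  (forall v, degree src tgt v != 2 -> pt_dist src tgt len d e0 s v0 <= pt_dist src tgt len d e0 s v) ->
  (forall v, degree src tgt v != 2 -> pt_dist src tgt len d e0 s v0 < s + d (src e0) v) \/
  (forall v, degree src tgt v != 2 -> pt_dist src tgt len d e0 s v0 < len e0 - s + d (tgt e0) v) ->
  0 < eta -> exists2 r, pt_dist src tgt len d e0 s v0 < r < pt_dist src tgt len d e0 s v0 + eta
    & pt_ball_len src tgt len d e0 s r != r *+ 2.
Proof.
move=> hs dv0 hmin [hstrict|hstrict] eta0; first exact: pt_ball_len_beyond.
have hs' : 0 < len e0 - s < len e0 by move: hs; lra.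
suff [r hr hne] : exists2 r, pt_dist tgt src len d e0 (len e0 - s) v0 < r
      < pt_dist tgt src len d e0 (len e0 - s) v0 + eta
    & pt_ball_len tgt src len d e0 (len e0 - s) r != r *+ 2.
  by exists r; rewrite ?pt_distC // pt_ball_lenC.
apply: pt_ball_len_beyond => //.
- by move=> e; rewrite eq_sym.
- by move=> u e; case: (d_lip u e).
- by move=> u v /d_inc [e he]; exists e; rewrite -incomingC.
- by rewrite -degreeC.
- by move=> v; rewrite -degreeC -!pt_distC => /hmin.
- by move=> v; rewrite -degreeC -!pt_distC => /hstrict.
Qed.

End Reversal.

(** * The path metric *)

Local Open Scope classical_set_scope.
Local Open Scope ring_scope.

Section Metric.
Variables (R : realType) (g : mgraph R).
Hypothesis hg : is_mgraph g.
Local Notation nv := (mg_nv g).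
Local Notation ne := (mg_ne g).
Local Notation src := (@mg_src _ g).
Local Notation tgt := (@mg_tgt _ g).
Local Notation len := (@mg_len _ g).
Implicit Types (u v a b : 'I_nv) (e f : 'I_ne) (w : seq ('I_ne * bool)) (x y z : gpt g).

Lemma len_gt0 e : 0 < len e. Proof. by case: hg. Qed.
Lemma loopless e : src e != tgt e. Proof. by case: hg. Qed.

Lemma walk_cat a b c w w' : is_walk a b w -> is_walk b c w' -> is_walk a c (w ++ w').
Proof.
elim: w a => [|[e dir] w IH] a /=; first by move=> /eqP ->.
by case: dir => /andP [-> h] /(IH _ h).
Qed.

Lemma walk_len_cat w w' : walk_len (w ++ w') = walk_len w + walk_len w' :> R.
Proof. by rewrite /walk_len big_cat. Qed.

Lemma walk_len_cons p w : walk_len (p :: w) = len p.1 + walk_len w :> R.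
Proof. by rewrite /walk_len big_cons. Qed.

Lemma walk_len_nil : @walk_len R g [::] = 0.
Proof. by rewrite /walk_len big_nil. Qed.

Lemma walk_len_ge0 w : 0 <= walk_len w :> R.
Proof. by apply: sumr_ge0 => p _; exact: ltW (len_gt0 _). Qed.

Lemma walk_edge e : is_walk (src e) (tgt e) [:: (e, true)].
Proof. by rewrite /= !eqxx. Qed.

Lemma walk_edgeV e : is_walk (tgt e) (src e) [:: (e, false)].
Proof. by rewrite /= !eqxx. Qed.

Lemma walk_len1 e dir : walk_len [:: (e, dir)] = len e.
Proof. by rewrite walk_len_cons walk_len_nil addr0. Qed.

Lemma walk_rev a b w : is_walk a b w -> exists2 w', is_walk b a w' & walk_len w' = walk_len w.
Proof.
elim: w a => [|[e dir] w IH] a /=; first by move=> /eqP ->; exists [::] => /=.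
case: dir => /andP [/eqP <- /IH [w' h1 h2]].
  exists (w' ++ [:: (e, false)]); first exact: walk_cat h1 (walk_edgeV e).
  by rewrite walk_len_cat walk_len1 walk_len_cons /= h2 addrC.
exists (w' ++ [:: (e, true)]); first exact: walk_cat h1 (walk_edge e).
by rewrite walk_len_cat walk_len1 walk_len_cons /= h2 addrC.
Qed.

Definition vdist a b : R := inf [set r | exists2 w, is_walk a b w & r = walk_len w].

Lemma vdist_le a b w : is_walk a b w -> vdist a b <= walk_len w.
Proof.
move=> h; apply: ge_inf; last by exists w.
by exists 0 => _ [w' _ ->]; exact: walk_len_ge0.
Qed.

Lemma vdist_ge m a b : (forall w, is_walk a b w -> m <= walk_len w) -> m <= vdist a b.
Proof.
move=> h; apply: lb_le_inf; last by move=> _ [w hw ->]; exact: h.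
by case: hg => _ _ _ _ /(_ a b) [w hw]; exists (walk_len w), w.
Qed.

Lemma vdist_ge0 a b : 0 <= vdist a b.
Proof. by apply: vdist_ge => w _; exact: walk_len_ge0. Qed.

Lemma vdistxx a : vdist a a = 0.
Proof.
apply/eqP; rewrite eq_le vdist_ge0 andbT -walk_len_nil; apply: vdist_le => /=.
exact: eqxx.
Qed.

Lemma vdistC a b : vdist a b = vdist b a.
Proof.
apply/eqP; rewrite eq_le; apply/andP; split; apply: vdist_ge => w /walk_rev [w' h <-];
exact: vdist_le.
Qed.

Lemma vdist_tri a b c : vdist a c <= vdist a b + vdist b c.
Proof.
rewrite -lerBlDr; apply: vdist_ge => w hw; rewrite lerBlDr -lerBlDl.
apply: vdist_ge => w' hw'; rewrite lerBlDl -walk_len_cat.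
exact: vdist_le (walk_cat hw hw').
Qed.

Lemma vdist_edge e : vdist (src e) (tgt e) <= len e.
Proof. by rewrite -(walk_len1 e true); exact: vdist_le (walk_edge e). Qed.

Lemma vdist_lip u e :
  vdist u (src e) <= vdist u (tgt e) + len e /\ vdist u (tgt e) <= vdist u (src e) + len e.
Proof.
move: (vdist_tri u (src e) (tgt e)) (vdist_tri u (tgt e) (src e)) (vdist_edge e).
by rewrite (vdistC (tgt e) (src e)); lra.
Qed.

(** The infimum over walks need not be shown to be attained: only finitely many first steps out of
    [v] exist, and one that minimises [F], its length plus the distance from its end to [u], bounds
    all walks from below. *)
Lemma vdist_incoming u v : v != u -> exists e, incoming src tgt len (vdist u) v e.
Proof.
move=> vu.
pose stp (p : 'I_ne * bool) := if p.2 then (src p.1, tgt p.1) else (tgt p.1, src p.1).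
pose F p := vdist u (stp p).2 + len p.1.
have walk_stp w : is_walk v u w -> exists2 p, (stp p).1 == v & F p <= walk_len w.
  case: w => [|[e dir] w] /=; first by rewrite (negbTE vu).
  case: dir => /andP [h1 h2]; [exists (e, true) | exists (e, false)] => //;
  by rewrite /F /= walk_len_cons addrC lerD2l vdistC vdist_le.
have [w0 hw0] : exists w, is_walk v u w by case: hg.
have [p0 hp0 _] := walk_stp w0 hw0.
have [p hp pmin] : exists2 p, (stp p).1 == v & forall q, (stp q).1 == v -> F p <= F q.
  by case: (arg_minP F (P := fun p => (stp p).1 == v) hp0) => p hp pmin; exists p.
have Fle : F p <= vdist u v.
  by rewrite vdistC; apply: vdist_ge => w /walk_stp [q /pmin]; exact: le_trans.
exists p.1; move: hp Fle (vdist_lip u p.1); rewrite /F /incoming /stp.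
case: p.2 => /= /eqP <- h [h1 h2]; rewrite eqxx /=; apply/orP; [left|right];
by rewrite eq_le ?h1 ?h2.
Qed.

Lemma vdist_gt0 a b : a != b -> 0 < vdist a b.
Proof.
rewrite eq_sym => /vdist_incoming [e]; move: (len_gt0 e).
by rewrite /incoming => l0 /orP [] /andP [_ /eqP ->];
rewrite ltr_wpDl // vdist_ge0.
Qed.

Lemma incident_edge v : exists e, src e = v \/ tgt e = v.
Proof.
case: hg => ne0 _ nol _ conn.
pose e0 := Ordinal ne0.
have [u uv] : exists u, v != u.
  by have [<-|h] := eqVneq (src e0) v; [exists (tgt e0) | exists (src e0); rewrite eq_sym].
have [[|[e dir] w]] := conn v u; first by rewrite /= (negbTE uv).
by case: dir => /= /andP [/eqP <- _]; exists e; [left|right].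
Qed.

(** Clamping at both ends parametrises the closed edge by all reals with valid points only, which
    suits arguments on real intervals. *)
Definition onedge e t : gpt g :=
  if t <= 0 then GV (src e) else if len e <= t then GV (tgt e) else GE e t.

Lemma valid_onedge e t : valid (onedge e t).
Proof. by rewrite /onedge; case: leP => // ?; case: leP => //= ?; apply/andP. Qed.

Lemma onedge0 e : onedge e 0 = GV (src e).
Proof. by rewrite /onedge lexx. Qed.

Lemma onedge_len e : onedge e (len e) = GV (tgt e).
Proof. by rewrite /onedge lexx leNgt len_gt0. Qed.

Lemma onedge_in e t : 0 < t < len e -> onedge e t = GE e t.
Proof. by case/andP => h1 h2; rewrite /onedge !leNgt h1 h2. Qed.

Lemma loc_onedge e t : 0 <= t <= len e -> loc (onedge e t) e t.
Proof.
case/andP; rewrite /onedge le_eqVlt => /predU1P [<-|t0]; first by rewrite lexx /=; left.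
rewrite le_eqVlt => /predU1P [->|t1]; last by rewrite !leNgt t0 t1 /=.
by rewrite lexx leNgt len_gt0 /=; right.
Qed.

Lemma onedgeP x : valid x -> exists e t, 0 <= t <= len e /\ x = onedge e t.
Proof.
case: x => [v _|e t /= h].
  have [e [<-|<-]] := incident_edge v.
    by exists e, 0; rewrite onedge0 lexx ltW ?len_gt0.
  by exists e, (len e); rewrite onedge_len lexx ltW ?len_gt0.
by exists e, t; rewrite onedge_in //; case/andP: h => /ltW -> /ltW ->.
Qed.

Lemma loc_le x e s : valid x -> loc x e s -> 0 <= s <= len e.
Proof.
case: x => [v _ [] [_ ->]|e' t /= /andP [/ltW h1 /ltW h2] [<- ->]];
by rewrite ?lexx ?h1 ?h2 ?(ltW (len_gt0 _)).
Qed.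

Lemma loc_ex x : exists e s, loc x e s.
Proof.
case: x => [v|e t]; last by exists e, t.
have [e [<-|<-]] := incident_edge v; first by exists e, 0; left.
by exists e, (len e); right.
Qed.

Lemma reach_ge0 x a c : valid x -> reach x a c -> 0 <= c.
Proof.
move=> vx [e [s [/(loc_le vx) /andP [h1 h2] [] [_ ->]]]] //.
by rewrite subr_ge0.
Qed.

Section Gdist.
Variables (x y : gpt g).
Hypotheses (vx : valid x) (vy : valid y).

Lemma path_lengths_lb : has_lbound (path_lengths x y).
Proof.
exists 0 => r [[e [s [t [_ _ ->]]]]|]; first exact: normr_ge0.
move=> [a [b [c1 [c2 [w [/(reach_ge0 vx) h1 /(reach_ge0 vy) h2 _ ->]]]]]].
by rewrite !addr_ge0 ?walk_len_ge0.
Qed.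

Lemma gdist_le_loc e s t : loc x e s -> loc y e t -> gdist x y <= `|s - t|.
Proof.
by move=> h1 h2; apply: ge_inf; [exact: path_lengths_lb | left; exists e, s, t].
Qed.

Lemma gdist_le_reach a b c1 c2 : reach x a c1 -> reach y b c2 ->
  gdist x y <= c1 + vdist a b + c2.
Proof.
move=> h1 h2; rewrite -lerBlDr -lerBlDl; apply: vdist_ge => w hw.
rewrite lerBlDl lerBlDr; apply: ge_inf; first exact: path_lengths_lb.
by right; exists a, b, c1, c2, w.
Qed.

Lemma gdist_ge m : (forall e s t, loc x e s -> loc y e t -> m <= `|s - t|) ->
  (forall a b c1 c2, reach x a c1 -> reach y b c2 -> m <= c1 + vdist a b + c2) ->
  m <= gdist x y.
Proof.
move=> h1 h2; apply: lb_le_inf.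
  have [e [s hs]] := loc_ex x; have [f [t ht]] := loc_ex y.
  case: hg => _ _ _ _ /(_ (src e) (src f)) [w hw].
  exists (s + walk_len w + t); right; exists (src e), (src f), s, t, w; split=> //.
    by exists e, s; split=> //; left.
  by exists f, t; split=> //; left.
move=> r [[e [s [t [hs ht ->]]]]|]; first exact: h1 hs ht.
move=> [a [b [c1 [c2 [w [hx hy hw ->]]]]]].
by apply: le_trans (h2 _ _ _ _ hx hy) _; rewrite lerD2r lerD2l vdist_le.
Qed.

Lemma gdist_ge0 : 0 <= gdist x y.
Proof.
apply: gdist_ge => [e s t _ _|a b c1 c2 /(reach_ge0 vx) h1 /(reach_ge0 vy) h2].
  exact: normr_ge0.
by rewrite !addr_ge0 ?vdist_ge0.
Qed.

End Gdist.

Lemma gdistC x y : gdist x y = gdist y x.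
Proof.
rewrite /gdist; congr inf; apply/seteqP; split.
  move=> r [[e [s [t [hs ht ->]]]]|]; first by left; exists e, t, s; rewrite distrC.
  move=> [a [b [c1 [c2 [w [hx hy /walk_rev [w' hw' E] ->]]]]]].
  right; exists b, a, c2, c1, w'; split=> //; rewrite E; lra.
move=> r [[e [s [t [hs ht ->]]]]|]; first by left; exists e, t, s; rewrite distrC.
move=> [a [b [c1 [c2 [w [hx hy /walk_rev [w' hw' E] ->]]]]]].
right; exists b, a, c2, c1, w'; split=> //; rewrite E; lra.
Qed.

Lemma gdistxx x : valid x -> gdist x x = 0.
Proof.
move=> vx; apply/eqP; rewrite eq_le gdist_ge0 // andbT.
have [e [s hs]] := loc_ex x.
by rewrite (le_trans (gdist_le_loc vx vx hs hs)) // subrr normr0.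
Qed.

Lemma reach_vertex v a (c : R) : reach (GV v) a c -> vdist v a <= c.
Proof.
move=> [e [s [[] [-> ->] [] [-> ->]]]] /=; rewrite ?vdistxx ?subr0 ?subrr //.
- exact: vdist_edge.
- by rewrite vdistC vdist_edge.
Qed.

Lemma reach_reach x a b c1 c2 : valid x -> reach x a c1 -> reach x b c2 -> vdist a b <= c1 + c2.
Proof.
case: x => [v _|f t /= /andP [t0 t1]].
  move=> /reach_vertex h1 /reach_vertex h2; move: (vdist_tri a v b); rewrite (vdistC a v); lra.
have ve := vdist_edge f.
move=> [e [s [[<- ->] h1]]] [e' [s' [[<- ->] h2]]].
case: h1 => -[-> ->]; case: h2 => -[-> ->]; rewrite ?vdistxx ?(vdistC (tgt f)); lra.
Qed.

(** A leg from [x] to [y] within one edge followed by an exit from [y] can be replaced by an exit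
    from [x], which reduces such a concatenation in the triangle inequality to walks between
    vertices. *)
Lemma loc_reach x y e s t b c : valid y ->
  loc x e s -> loc y e t -> reach y b c ->
  exists a c', reach x a c' /\ c' + vdist a b <= `|s - t| + c.
Proof.
move=> vy hx; case: y vy => [v _|f t0 /= /andP [t00 t01]].
  have rx a c' : (a = src e /\ c' = s) \/ (a = tgt e /\ c' = len e - s) -> reach x a c'.
    by move=> h; exists e, s.
  move=> [] [-> ->] /reach_vertex hb.
    exists (src e), s; split; first by apply: rx; left.
    by rewrite subr0; move: (ler_norm s) hb; lra.
  exists (tgt e), (len e - s); split; first by apply: rx; right.
  by rewrite distrC; move: (ler_norm (len e - s)) hb; lra.
move=> [ef et] [e' [s' [[ef' es'] h2]]]; subst f e' s' t.
case: h2 => -[-> ->].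
  exists (src e), s; split; first by exists e, s; split=> //; left.
  by rewrite vdistxx addr0; move: (ler_norm (s - t0)); lra.
exists (tgt e), (len e - s); split; first by exists e, s; split=> //; right.
by rewrite vdistxx addr0 distrC; move: (ler_norm (t0 - s)); lra.
Qed.

Lemma gdist_tri x y z : valid x -> valid y -> valid z ->
  gdist x z <= gdist x y + gdist y z.
Proof.
move=> vx vy vz; rewrite -lerBlDr; apply: gdist_ge => //.
  move=> e s t hs ht; rewrite lerBlDr -lerBlDl; apply: gdist_ge => //.
    move=> f s' t' hs' ht'; rewrite lerBlDl.
    (* Both legs stay inside edges. If [y] is interior the two edges coincide; if [y] is a vertex,
       both legs are exits to it. *)
    case: y vy ht hs' => [v _|f0 t0 _]; last first.
      move=> [? ?] [? ?]; subst.
      by apply: le_trans (gdist_le_loc vx vz hs ht') _; exact: ler_distD.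
    have key2 (e1 : 'I_ne) s1 t1 (p : gpt g) : loc p e1 s1 -> loc (GV v) e1 t1 ->
       exists2 c, reach p v c & c <= `|s1 - t1|.
      move=> h [] [-> ->].
        by exists s1; [exists e1, s1; split=> //; left | rewrite subr0 ler_norm].
      by exists (len e1 - s1); [exists e1, s1; split=> //; right | rewrite distrC ler_norm].
    move=> /(key2 _ _ _ _ hs) [c1 r1 l1] /(key2 _ _ _ _ ht') [c2 r2 l2].
    move: (gdist_le_reach vx vz r1 r2) l2; rewrite vdistxx (distrC t'); lra.
  move=> a b c1 c2 ha hb; have [a' [c' [r' l']]] := loc_reach vy hs ht ha.
  by rewrite lerBlDl; move: (gdist_le_reach vx vz r' hb) (vdist_tri a' a b); lra.
move=> a b c1 c2 ha hb; rewrite lerBlDr -lerBlDl; apply: gdist_ge => //.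
  move=> e s t hs ht; have [a' [c' [r' l']]] := loc_reach vy ht hs hb.
  rewrite lerBlDl; move: (gdist_le_reach vx vz ha r') (vdistC a' b) (vdist_tri a b a').
  by rewrite (distrC t) in l'; lra.
move=> a' b' c1' c2' ha' hb'; rewrite lerBlDl.
move: (gdist_le_reach vx vz ha hb') (reach_reach vy hb ha') (vdist_tri a b b') (vdist_tri b a' b').
lra.
Qed.

Lemma reach_loc x e s : loc x e s -> reach x (src e) s /\ reach x (tgt e) (len e - s).
Proof. by move=> h; split; exists e, s; split=> //; [left|right]. Qed.

Lemma reach_edge e t a (c : R) : reach (GE e t) a c ->
  (a = src e /\ c = t) \/ (a = tgt e /\ c = len e - t).
Proof. by move=> [f [s [[<- ->]]]]. Qed.

Lemma reach_self v : reach (GV v) v 0.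
Proof.
have [e [E|E]] := incident_edge v.
  by exists e, 0; rewrite E; split; left.
by exists e, (len e); rewrite E subrr; split; right.
Qed.

Lemma gdist_vertices a b : gdist (GV a) (GV b) = vdist a b.
Proof.
apply/eqP; rewrite eq_le; apply/andP; split.
  have := @gdist_le_reach (GV a) (GV b) I I _ _ _ _ (reach_self a) (reach_self b).
  by rewrite add0r addr0.
apply: gdist_ge => // [e s t [] [-> ->] [] [-> ->]|a' b' c1 c2 /reach_vertex h1 /reach_vertex h2].
- by rewrite vdistxx normr_ge0.
- by rewrite sub0r normrN ger0_norm ?vdist_edge // ltW ?len_gt0.
- by rewrite subr0 ger0_norm ?(ltW (len_gt0 _)) // vdistC vdist_edge.
- by rewrite vdistxx normr_ge0.
move: (vdist_tri a a' b) (vdist_tri a' b' b); rewrite (vdistC b' b); lra.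
Qed.

Lemma gdist_edge e s t : valid (@GE _ g e s) -> valid (@GE _ g e t) ->
  gdist (GE e s) (GE e t) = Num.min `|s - t|
   (Num.min (pt_dist src tgt len vdist e s (src e) + t)
            (pt_dist src tgt len vdist e s (tgt e) + (len e - t))).
Proof.
move=> vs vt; apply/eqP; rewrite eq_le; apply/andP; split.
  rewrite le_min; apply/andP; split; first exact: gdist_le_loc.
  have [r1 r2] := @reach_loc (GE e s) e s (conj erefl erefl).
  have [r3 r4] := @reach_loc (GE e t) e t (conj erefl erefl).
  by rewrite /pt_dist le_min -!lerBlDr !le_min !lerBlDr !(gdist_le_reach vs vt).
apply: gdist_ge => // [f s' t' [<- ->] [_ ->]|a b c1 c2]; first by rewrite ge_min lexx.
by move=> /reach_edge [] [-> ->] /reach_edge [] [-> ->]; rewrite /pt_dist !ge_min ?lerD2r !ge_min !lexx ?orbT.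
Qed.

Lemma gdist_edges e f s t : e != f -> valid (@GE _ g e s) -> valid (@GE _ g f t) ->
  gdist (GE e s) (GE f t) =
   Num.min (pt_dist src tgt len vdist e s (src f) + t)
            (pt_dist src tgt len vdist e s (tgt f) + (len f - t)).
Proof.
move=> ef vs vt; apply/eqP; rewrite eq_le; apply/andP; split.
  have [r1 r2] := @reach_loc (GE e s) e s (conj erefl erefl).
  have [r3 r4] := @reach_loc (GE f t) f t (conj erefl erefl).
  by rewrite /pt_dist le_min -!lerBlDr !le_min !lerBlDr !(gdist_le_reach vs vt).
apply: gdist_ge => // [e' s' t' [<- ->] [E _]|a b c1 c2]; first by rewrite E eqxx in ef.
by move=> /reach_edge [] [-> ->] /reach_edge [] [-> ->]; rewrite /pt_dist !ge_min ?lerD2r !ge_min !lexx ?orbT.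
Qed.

Lemma gdist_edge_vertex e s v : valid (@GE _ g e s) ->
  gdist (GE e s) (GV v) = pt_dist src tgt len vdist e s v.
Proof.
move=> vs; apply/eqP; rewrite eq_le; apply/andP; split.
  have [r1 r2] := @reach_loc (GE e s) e s (conj erefl erefl).
  move: (@gdist_le_reach _ (GV v) vs I _ _ _ _ r1 (reach_self v)).
  move: (@gdist_le_reach _ (GV v) vs I _ _ _ _ r2 (reach_self v)).
  by rewrite !addr0 /pt_dist le_min => -> ->.
apply: gdist_ge => // [f s' t' [<- ->] [] [-> ->]|a b c1 c2].
- by rewrite /pt_dist vdistxx addr0 subr0 ge_min ler_norm.
- by rewrite /pt_dist vdistxx addr0 distrC ge_min ler_norm orbT.
move: (vdist_tri (src e) b v) (vdist_tri (tgt e) b v) => t1 t2.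
move=> /reach_edge [] [Ea ->] /reach_vertex; rewrite Ea (vdistC v) => h; rewrite /pt_dist ge_min;
  apply/orP; [left|right]; lra.
Qed.

Lemma gdist_vertex_edge v e t : valid (@GE _ g e t) ->
  gdist (GV v) (GE e t) = Num.min (vdist v (src e) + t) (vdist v (tgt e) + (len e - t)).
Proof.
by move=> vt; rewrite gdistC gdist_edge_vertex // /pt_dist !(vdistC v) !(addrC (vdist _ _)).
Qed.

Lemma gdist_onedge e s t : 0 <= s <= len e -> 0 <= t <= len e ->
  gdist (onedge e s) (onedge e t) <= `|s - t|.
Proof.
by move=> hs ht; apply: gdist_le_loc; (exact: valid_onedge || exact: loc_onedge).
Qed.

Lemma gdist_eq0 x y : valid x -> valid y -> gdist x y <= 0 -> x = y.
Proof.
have mixed v e t : valid (@GE _ g e t) -> gdist (GV v) (GE e t) <= 0 -> False.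
  move=> /[dup] /andP [t0 t1] ht; rewrite gdist_vertex_edge // ge_min.
  by move: (vdist_ge0 v (src e)) (vdist_ge0 v (tgt e)) => ? ? /orP []; lra.
case: x => [v|e s] vx; case: y => [w|f t] vy.
- rewrite gdist_vertices => h; congr GV; apply/eqP; apply: contraTT h.
  by rewrite -ltNge; exact: vdist_gt0.
- by move=> /(mixed _ _ _ vy).
- by rewrite gdistC => /(mixed _ _ _ vx).
have pos v : 0 < pt_dist src tgt len vdist e s v by apply: pt_dist_gt0 => //; exact: vdist_ge0.
case: (eqVneq e f) vy => [<-|ef] vy.
  rewrite gdist_edge // !ge_min => /orP [|/orP []].
  - by rewrite normr_le0 subr_eq0 => /eqP ->.
  - by move: vy (pos (src e)) => /= /andP [? ?] ? ?; exfalso; lra.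
  - by move: vy (pos (tgt e)) => /= /andP [? ?] ? ?; exfalso; lra.
rewrite gdist_edges // ge_min => /orP [].
- by move: vy (pos (src f)) => /= /andP [? ?] ? ?; exfalso; lra.
- by move: vy (pos (tgt f)) => /= /andP [? ?] ? ?; exfalso; lra.
Qed.

(* [gdist] is the largest pseudometric that is dominated by arclength on every edge. *)
Lemma gdist_maximal (D : gpt g -> gpt g -> R) :
  (forall x, valid x -> D x x <= 0) ->
  (forall x y z, valid x -> valid y -> valid z -> D x z <= D x y + D y z) ->
  (forall x y e s t, valid x -> valid y -> loc x e s -> loc y e t -> D x y <= `|s - t|) ->
  forall x y, valid x -> valid y -> D x y <= gdist x y.
Proof.
move=> Dxx Dtri Dloc x y vx vy.
have ls e : loc (GV (src e)) e 0 by left.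
have lt e : loc (GV (tgt e)) e (len e) by right.
have walk a b w : is_walk a b w -> D (GV a) (GV b) <= walk_len w.
  elim: w a => [|[e dir] w IH] a /=; first by move=> /eqP ->; rewrite walk_len_nil Dxx.
  have l0 := ltW (len_gt0 e).
  rewrite walk_len_cons /=; case: dir => /andP [/eqP <- /IH h].
    have := Dtri (GV (src e)) (GV (tgt e)) (GV b) I I I.
    have := Dloc (GV (src e)) (GV (tgt e)) e _ _ I I (ls e) (lt e).
    by rewrite sub0r normrN ger0_norm //; lra.
  have := Dtri (GV (tgt e)) (GV (src e)) (GV b) I I I.
  have := Dloc (GV (tgt e)) (GV (src e)) e _ _ I I (lt e) (ls e).
  by rewrite subr0 ger0_norm //; lra.
have reachl z a c : valid z -> reach z a c -> D z (GV a) <= c /\ D (GV a) z <= c.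
  move=> vz [e [s [hl hc]]]; have /andP [s0 s1] := loc_le vz hl.
  case: hc => -[-> ->]; split.
  - by have := Dloc z (GV (src e)) e _ _ vz I hl (ls e); rewrite subr0 ger0_norm.
  - by have := Dloc (GV (src e)) z e _ _ I vz (ls e) hl; rewrite sub0r normrN ger0_norm.
  - by have := Dloc z (GV (tgt e)) e _ _ vz I hl (lt e); rewrite distrC ger0_norm ?subr_ge0.
  - by have := Dloc (GV (tgt e)) z e _ _ I vz (lt e) hl; rewrite ger0_norm ?subr_ge0.
apply: gdist_ge => // [e s t hs ht|a b c1 c2 /(reachl _ _ _ vx) [h1 _] /(reachl _ _ _ vy) [_ h2]].
  exact: Dloc hs ht.
have h3 : D (GV a) (GV b) <= vdist a b by apply: vdist_ge => // w; exact: walk.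
by have := Dtri x (GV a) y vx I vy; have := Dtri (GV a) (GV b) y I I vy; lra.
Qed.

End Metric.

(** * Measures of balls *)

Section TwoEnds.
Variable R : realType.
Implicit Types a b p q : R.

Definition two_ends a b p q : set R := [set t | a < t < b /\ (t <= a + p \/ b - q <= t)].

(** Arbitrary sets are allowed because the measure is given by an outer measure; preimages under
    [phi] are then covered too. *)
Lemma le_lebesgue (A B : set R) : A `<=` B -> (lebesgue_measure A <= lebesgue_measure B)%E.
Proof. by move=> AB; exact: (le_outer_measure (wlength idfun)^*%mu). Qed.

Lemma lebesgue_ge0 (A : set R) : (0 <= lebesgue_measure A)%E.
Proof. exact: (outer_measure_ge0 (wlength idfun)^*%mu). Qed.

Lemma two_ends_full a b p q : b - a <= p + q -> two_ends a b p q = `]a, b[%classic.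
Proof.
move=> h; apply/seteqP; split=> t /=; rewrite in_itv /=; first by case.
move=> tab; split=> //; case: (leP t (a + p)) => ht; first by left.
by right; lra.
Qed.

Lemma two_ends_split a b p q : 0 <= p -> 0 <= q -> p + q < b - a ->
  two_ends a b p q = `]a, a + p]%classic `|` `[b - q, b[%classic.
Proof.
move=> p0 q0 h; apply/seteqP; split=> t /=; rewrite !in_itv /=.
  by move=> [/andP [-> ->] [->|->]]; [left|right].
by move=> [] /andP [h1 h2]; split; [apply/andP; split; lra|left; lra|apply/andP; split; lra|right].
Qed.

Lemma measurable_two_ends a b p q : 0 <= p -> 0 <= q -> measurable (two_ends a b p q).
Proof.
move=> p0 q0; case: (leP (b - a) (p + q)) => h.
  by rewrite two_ends_full //; exact: measurable_itv.
by rewrite two_ends_split //; apply: measurableU; exact: measurable_itv.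
Qed.

Lemma lebesgue_two_ends a b p q : a < b -> 0 <= p -> 0 <= q ->
  lebesgue_measure (two_ends a b p q) = (Num.min (b - a) (p + q))%:E.
Proof.
move=> ab p0 q0; case: (leP (b - a) (p + q)) => h.
  by rewrite two_ends_full // lebesgue_measure_itv /= lte_fin ab EFinB.
have E1 : lebesgue_measure `]a, a + p]%classic = p%:E.
  rewrite lebesgue_measure_itv /= lte_fin; case: ltP => hp.
    by rewrite -EFinB; congr EFin; lra.
  by congr EFin; lra.
have E2 : lebesgue_measure `[b - q, b[%classic = q%:E.
  rewrite lebesgue_measure_itv /= lte_fin; case: ltP => hp.
    by rewrite -EFinB; congr EFin; lra.
  by congr EFin; lra.
rewrite two_ends_split // EFinD -E1 -E2; apply: measureU => //.
apply/seteqP; split=> t //=; rewrite !in_itv /= => -[/andP [? ?] /andP [? ?]]; lra.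
Qed.

Lemma lebesgue_itv_gt0 (A : set R) a b : a < b -> (forall t, a < t < b -> A t) ->
  (0 < lebesgue_measure A)%E.
Proof.
move=> ab h; apply: (@lt_le_trans _ _ (lebesgue_measure `]a, b[%classic)).
  by rewrite lebesgue_measure_itv /= lte_fin ab -EFinB lte_fin subr_gt0.
by apply: le_lebesgue => t /=; rewrite in_itv /=; exact: h.
Qed.

End TwoEnds.

Section Balls.
Variables (R : realType) (g : mgraph R).
Hypothesis hg : is_mgraph g.
Local Notation nv := (mg_nv g).
Local Notation ne := (mg_ne g).
Local Notation src := (@mg_src _ g).
Local Notation tgt := (@mg_tgt _ g).
Local Notation len := (@mg_len _ g).
Implicit Types (u v : 'I_nv) (e f : 'I_ne) (x y z : gpt g) (A B : set (gpt g)).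

Local Notation vdist := (vdist (g := g)).
Local Notation pt_dist := (pt_dist src tgt len vdist).

Definition length_of A : \bar R := (\sum_(e < ne) lebesgue_measure (edge_slice A e))%E.

Lemma total_len_gt0 : 0 < total_len g.
Proof.
have [ne0 _ _ _ _] := hg.
rewrite /total_len (bigD1 (Ordinal ne0)) //= ltr_pwDl ?len_gt0 //.
by apply: sumr_ge0 => e _; apply/ltW/len_gt0.
Qed.

Lemma length_gt0 A e (s t : R) : 0 <= s -> s < t -> t <= len e ->
  (forall r, s < r < t -> A (GE e r)) -> (0 < length_of A)%E.
Proof.
move=> s0 st te h; rewrite /length_of (bigD1 e) //=.
apply: (@lt_le_trans _ _ (lebesgue_measure (edge_slice A e))).
  apply: (lebesgue_itv_gt0 st) => r /[dup] sr /andP [sr' rt]; split; last exact: h.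
  by apply/andP; split; lra.
by apply: leeDl; apply: sume_ge0 => f _; exact: lebesgue_ge0.
Qed.

Definition gball x (r : R) : set (gpt g) := [set y | valid y /\ gdist x y <= r].

Lemma edge_in_gball x (r : R) : valid x -> 0 < r -> exists e s t,
  [/\ 0 <= s, s < t, t <= len e & forall q, s < q < t -> gdist x (GE e q) < r].
Proof.
move=> /(onedgeP hg) [e [t0 [/andP [h0 h1] ->]]] r0; have l0 := len_gt0 hg e.
exists e, (Num.max 0 (t0 - r)), (Num.min (len e) (t0 + r)); split.
- by rewrite le_max lexx.
- by rewrite gt_max !lt_min l0 /=; apply/and3P; split; lra.
- by rewrite ge_min lexx.
move=> q; rewrite gt_max lt_min => /andP [/andP [q0 q1] /andP [q2 q3]].
rewrite -onedge_in ?q0 // (le_lt_trans (gdist_onedge hg _ _)) ?h0 ?(ltW q0) ?(ltW q2) //.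
by rewrite ltr_distlC; apply/andP; split; lra.
Qed.

Lemma gball_gt0 x (r : R) : valid x -> 0 < r -> (0 < length_of (gball x r))%E.
Proof.
move=> vx r0; have [e [s [t [s0 st te h]]]] := edge_in_gball vx r0.
apply: (length_gt0 s0 st te) => q /[dup] /h /ltW hq /andP [sq qt]; split=> //=.
by apply/andP; split; lra.
Qed.

Lemma slice_two_ends A e (a b r : R) : (forall t, 0 < t < len e -> A (GE e t) <-> (a + t <= r \/ b + (len e - t) <= r)) ->
  edge_slice A e = two_ends 0 (len e) (pospart (r - a)) (pospart (r - b)).
Proof.
move=> h; apply/seteqP; split=> t /= [ht].
  move=> /(h _ ht) hA; split=> //; move: hA ht => [] ? /andP [? ?]; [left|right].
    by case: (pospartP (r - a)) => -[? ->]; lra.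
  by case: (pospartP (r - b)) => -[? ->]; lra.
move=> hA; split=> //; apply/(h _ ht); move: ht => /andP [? ?]; move: hA.
by case: (pospartP (r - a)) => -[? ->]; case: (pospartP (r - b)) => -[? ->] [] ?; (left; lra) || (right; lra).
Qed.

Lemma pospart_nneg (x : R) : 0 <= pospart x.
Proof. by rewrite /pospart le_max lexx. Qed.

Lemma lebesgue_slice_two_ends e (a b r : R) : 
  lebesgue_measure (two_ends 0 (len e) (pospart (r - a)) (pospart (r - b))) = (piece_len (len e) a b r)%:E.
Proof. by rewrite lebesgue_two_ends ?pospart_nneg ?len_gt0 // subr0. Qed.

Lemma gball_vertex_slice v (r : R) e : edge_slice (gball (GV v) r) e =
  two_ends 0 (len e) (pospart (r - vdist v (src e))) (pospart (r - vdist v (tgt e))).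
Proof.
apply: slice_two_ends => t ht; rewrite /gball /= gdist_vertex_edge // ge_min.
by split=> [[_ /orP]|/orP].
Qed.

Lemma gball_edge_slice e0 (s r : R) e : e != e0 -> valid (@GE _ g e0 s) ->
  edge_slice (gball (GE e0 s) r) e =
  two_ends 0 (len e) (pospart (r - pt_dist e0 s (src e))) (pospart (r - pt_dist e0 s (tgt e))).
Proof.
move=> ee vs; apply: slice_two_ends => t ht; rewrite /gball /= gdist_edges // 1?eq_sym // ge_min.
by split=> [[_ /orP]|/orP].
Qed.

(** The two halves of the edge are pieces with one end at distance 0 from the centre; the centre
    itself is added apart because [two_ends] only contains points strictly inside its interval. *)
Lemma gball_same_slice e0 (s r : R) : 0 <= r -> valid (@GE _ g e0 s) ->
  edge_slice (gball (GE e0 s) r) e0 =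
  two_ends 0 s (pospart (r - pt_dist e0 s (src e0))) r `|`
  (two_ends s (len e0) r (pospart (r - pt_dist e0 s (tgt e0))) `|` [set s]).
Proof.
move=> r0 vs; have /andP [s0 s1] := vs.
have d1 : 0 < pt_dist e0 s (src e0) by apply: pt_dist_gt0 => //; exact: vdist_ge0.
have d2 : 0 < pt_dist e0 s (tgt e0) by apply: pt_dist_gt0 => //; exact: vdist_ge0.
apply/seteqP; split=> t /=.
  move=> [/[dup] ht /andP [t0 t1] [_]]; rewrite gdist_edge // !ge_min => H.
  case: (ltgtP t s) => ts; [left|right; left|by right; right].
    split; first by apply/andP.
    case/orP: H => [|/orP [] ?]; first by rewrite ler_distlC => /andP [? ?]; right.
      by left; rewrite pospart_ge0; lra.
    by right; lra.
  split; first by apply/andP.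
  case/orP: H => [|/orP [] ?]; first by rewrite ler_distlC => /andP [? ?]; left.
    by left; lra.
  by right; rewrite pospart_ge0; lra.
have key : 0 < t < len e0 -> (`|s - t| <= r \/ pt_dist e0 s (src e0) + t <= r \/ pt_dist e0 s (tgt e0) + (len e0 - t) <= r) ->
    0 < t < len e0 /\ 0 < t < len e0 /\ gdist (GE e0 s) (GE e0 t) <= r.
  move=> ht H; do 2!split=> //; rewrite gdist_edge // !ge_min.
  by case: H => [->//|[->|->]]; rewrite !orbT.
move=> [|[|Ets]].
- move=> [/andP [t0 ts] H]; apply: key; first by apply/andP; split; lra.
  case: H => H; last by left; rewrite ler_distlC; apply/andP; split; lra.
  by move: H; case: (pospartP (r - pt_dist e0 s (src e0))) => -[? ->] ?; right; left; lra.
- move=> [/andP [t0 ts] H]; apply: key; first by apply/andP; split; lra.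
  case: H => H; first by left; rewrite ler_distlC; apply/andP; split; lra.
  by move: H; case: (pospartP (r - pt_dist e0 s (tgt e0))) => -[? ->] ?; right; right; lra.
by apply: key; rewrite Ets //; left; rewrite subrr normr0.
Qed.

Lemma lebesgue_same_slice e0 (s r : R) : 0 <= r -> valid (@GE _ g e0 s) ->
  lebesgue_measure (edge_slice (gball (GE e0 s) r) e0) =
  (piece_len s (pt_dist e0 s (src e0)) 0 r + piece_len (len e0 - s) 0 (pt_dist e0 s (tgt e0)) r)%:E.
Proof.
move=> r0 vs; have /andP [s0 s1] := vs; rewrite gball_same_slice //.
set S1 := two_ends _ _ _ _; set S2 := two_ends _ _ _ _.
have m1 : measurable S1 by apply: measurable_two_ends => //; exact: pospart_nneg.
have m2 : measurable S2 by apply: measurable_two_ends => //; exact: pospart_nneg.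
have m3 : measurable [set s] by exact: measurable_set1.
have E1 : lebesgue_measure S1 = (piece_len s (pt_dist e0 s (src e0)) 0 r)%:E.
  by rewrite lebesgue_two_ends ?pospart_nneg // /piece_len !subr0 (pospart_ge0 r0).
have E2 : lebesgue_measure S2 = (piece_len (len e0 - s) 0 (pt_dist e0 s (tgt e0)) r)%:E.
  by rewrite lebesgue_two_ends ?pospart_nneg // /piece_len !subr0 (pospart_ge0 r0).
have E23 : lebesgue_measure (S2 `|` [set s]) = lebesgue_measure S2.
  rewrite -[RHS]adde0 -(lebesgue_measure_set1 s); apply: measureU => //.
  by apply/seteqP; split=> t //= -[[/andP [h _] _] E]; rewrite E ltxx in h.
rewrite EFinD -E1 -E2 -E23; apply: measureU => //; first exact: measurableU.
apply/seteqP; split=> t //= -[[/andP [_ h] _] [[/andP [h' _] _]|E]]; last by rewrite E ltxx in h.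
by move: (lt_trans h h'); rewrite ltxx.
Qed.

Lemma measurable_gball x (r : R) : valid x -> 0 <= r -> mg_measurable (gball x r).
Proof.
case: x => [v|e0 s] vx r0 e.
  by rewrite gball_vertex_slice; apply: measurable_two_ends; exact: pospart_nneg.
case: (eqVneq e e0) => [->|ee]; last first.
  by rewrite gball_edge_slice //; apply: measurable_two_ends; exact: pospart_nneg.
rewrite gball_same_slice //; apply: measurableU.
  by apply: measurable_two_ends => //; exact: pospart_nneg.
apply: measurableU; last exact: measurable_set1.
by apply: measurable_two_ends => //; exact: pospart_nneg.
Qed.

Lemma length_gball_vertex v (r : R) : length_of (gball (GV v) r) = (ball_len src tgt len (vdist v) r)%:E.
Proof.
rewrite /length_of /ball_len -sumEFin; apply: eq_bigr => e _.
by rewrite gball_vertex_slice lebesgue_slice_two_ends.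
Qed.

Lemma length_gball_edge e0 (s r : R) : valid (@GE _ g e0 s) -> 0 <= r ->
  length_of (gball (GE e0 s) r) = (pt_ball_len src tgt len vdist e0 s r)%:E.
Proof.
move=> vs r0; rewrite /length_of /pt_ball_len (bigD1 e0) //= lebesgue_same_slice //.
rewrite -!addrA [X in _ = X%:E]addrC [RHS]EFinD -sumEFin; congr (_ + _)%E.
by apply: eq_bigr => e ee; rewrite gball_edge_slice // lebesgue_slice_two_ends.
Qed.

Lemma hdistE x (r : R) : hdist x r = (length_of (gball x r) * ((total_len g)^-1)%:E)%E.
Proof. by []. Qed.

Lemma length_gball_fin x (r : R) : valid x -> 0 <= r -> exists l : R, length_of (gball x r) = l%:E.
Proof.
case: x => [v|e s] vx r0; first by eexists; exact: length_gball_vertex.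
by eexists; exact: length_gball_edge.
Qed.

Lemma length_disjoint A B C : mg_measurable A -> mg_measurable B ->
  (forall x, valid x -> A x -> B x -> False) ->
  (forall x, valid x -> A x \/ B x -> C x) ->
  (length_of A + length_of B <= length_of C)%E.
Proof.
move=> mA mB AB hC; rewrite /length_of -big_split /=; apply: lee_sum => e _.
have : lebesgue_measure (edge_slice A e `|` edge_slice B e)
    = (lebesgue_measure (edge_slice A e) + lebesgue_measure (edge_slice B e))%E.
  apply: measureU; [exact: mA | exact: mB |].
  by apply/seteqP; split=> t //= -[[ht hA] [_ hB]]; exact: (AB (GE e t)).
move=> <-; apply: le_lebesgue => t /= [] [ht h]; split=> //; apply: hC => //; [left|right]; exact: h.
Qed.

End Balls.

(** * The distance to the nodes *)

Section Small.
Variables (R : realType) (g : mgraph R).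
Hypothesis hg : is_mgraph g.
Local Notation nv := (mg_nv g).
Local Notation ne := (mg_ne g).
Local Notation src := (@mg_src _ g).
Local Notation tgt := (@mg_tgt _ g).
Local Notation len := (@mg_len _ g).
Implicit Types (u v : 'I_nv) (e f : 'I_ne) (x y z : gpt g).
Local Notation vdist := (vdist (g := g)).
Local Notation pt_dist := (pt_dist src tgt len vdist).

Lemma vdist_separated : exists2 eps : R, 0 < eps &
  (forall e, eps <= len e) /\ (forall u v, u != v -> eps <= vdist u v).
Proof.
have [eps eps0 heps] := fin_pos_min len.
have hl e : eps <= len e by apply/heps/len_gt0.
exists eps => //; split=> // u v; rewrite eq_sym => /(vdist_incoming hg) [e].
by rewrite /incoming => /orP [] /andP [_ /eqP ->]; rewrite (le_trans (hl e)) // lerDr vdist_ge0.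
Qed.

Lemma pt_dist_ge e s v : valid (@GE _ g e s) -> s <= pt_dist e s v \/ len e - s <= pt_dist e s v.
Proof.
move=> _; have := vdist_ge0 hg (src e) v; have := vdist_ge0 hg (tgt e) v.
by rewrite /pt_dist; case: (leP (s + vdist (src e) v)) => _ ? ?; [left|right]; lra.
Qed.

Lemma length_gball_edge_small e s : valid (@GE _ g e s) -> exists2 eps : R, 0 < eps &
  forall r, 0 <= r <= eps -> length_of (gball (GE e s) r) = (r *+ 2)%:E.
Proof.
move=> vs; have /andP [s0 s1] := vs.
exists (Num.min s (len e - s)); first by rewrite lt_min s0 subr_gt0.
move=> r /andP [r0]; rewrite le_min => /andP [rs rl]; rewrite length_gball_edge //; congr EFin.
have small v : r - pt_dist e s v <= 0 by case: (pt_dist_ge v vs); lra.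
rewrite /pt_ball_len big1 ?add0r => [|f _]; last first.
  by rewrite /piece_len !pospart_le0 // addr0 min_r // ltW ?len_gt0.
by rewrite /piece_len !(pospart_le0 (small _)) subr0 (pospart_ge0 r0) addr0 add0r !min_r.
Qed.

(** At radii below all edge lengths and vertex distances each incident edge contributes [r], so
    small balls reveal the degree of their centre. *)
Lemma length_gball_vertex_small v : exists2 eps : R, 0 < eps &
  forall r, 0 <= r <= eps -> length_of (gball (GV v) r) = (r *+ degree src tgt v)%:E.
Proof.
have [eps eps0 [hl hd]] := vdist_separated; exists eps => // r /andP [r0 re].
rewrite length_gball_vertex //; congr EFin.
rewrite /ball_len /degree -sumr_const [RHS]big_mkcond; apply: eq_bigr => e _.
rewrite inE /incident /piece_len.
have far u : u != v -> pospart (r - vdist v u) = 0.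
  by rewrite eq_sym => /hd h; rewrite pospart_le0; lra.
have near : pospart (r - vdist v v) = r by rewrite vdistxx // subr0 pospart_ge0.
have l0 := hl e; have nl := loopless hg e.
case: (eqVneq (src e) v) nl => [-> vt|sv _] /=.
  by rewrite near far 1?eq_sym // addr0 min_r //; lra.
case: (eqVneq (tgt e) v) => [->|tv] /=; rewrite (far _ sv) add0r.
  by rewrite near min_r //; lra.
by rewrite far // min_r // ltW ?len_gt0.
Qed.

Definition node v := degree src tgt v != 2.

(** A specification rather than a function, since the minimum over nodes makes sense only once a
    node exists. *)
Definition node_dist (rad : gpt g -> R) := forall x,
  (exists2 v, node v & rad x = gdist x (GV v)) /\ (forall v, node v -> rad x <= gdist x (GV v)).

Lemma exists_node_dist v0 : node v0 -> exists rad, node_dist rad.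
Proof.
move=> nv0; exists (fun x => gdist x (GV [arg min_(v < v0 | node v) gdist x (GV v)]%O)) => x.
by case: arg_minP => // v nv hv; split=> //; exists v.
Qed.

Variable rad : gpt g -> R.
Hypothesis radP : node_dist rad.

Lemma rad_le x v : node v -> rad x <= gdist x (GV v). Proof. by case: (radP x) => _; exact. Qed.

Lemma rad_ge0 x : valid x -> 0 <= rad x.
Proof. by move=> vx; have [[v _ ->] _] := radP x; exact: gdist_ge0. Qed.

Lemma rad_lip x y : valid x -> valid y -> rad x <= rad y + gdist x y.
Proof.
move=> vx vy; have [[v nv ->] _] := radP y.
by rewrite (le_trans (rad_le _ nv)) // addrC gdist_tri.
Qed.

Lemma rad_dist x y : valid x -> valid y -> `|rad x - rad y| <= gdist x y.
Proof.
move=> vx vy; rewrite ler_distlC; have := rad_lip vx vy; have := rad_lip vy vx.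
by rewrite (gdistC y x) => ? ?; apply/andP; split; lra.
Qed.

Lemma rad_edge e t : valid (@GE _ g e t) ->
  rad (GE e t) = Num.min (t + rad (GV (src e))) (len e - t + rad (GV (tgt e))).
Proof.
move=> vt; apply/eqP; rewrite eq_le; apply/andP; split.
  rewrite le_min; apply/andP; split.
    have [[v nv ->] _] := radP (GV (src e)); apply: le_trans (rad_le _ nv) _.
    by rewrite gdist_edge_vertex // gdist_vertices // /pt_dist ge_min lexx.
  have [[v nv ->] _] := radP (GV (tgt e)); apply: le_trans (rad_le _ nv) _.
  by rewrite gdist_edge_vertex // gdist_vertices // /pt_dist ge_min lexx orbT.
have [[v nv ->] _] := radP (GE e t); rewrite gdist_edge_vertex // /pt_dist le_min !ge_min.
have := rad_le (GV (src e)) nv; have := rad_le (GV (tgt e)) nv; rewrite !gdist_vertices // => h1 h2.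
by apply/andP; split; apply/orP; [left|right]; lra.
Qed.

(** The parameter where the two branches of [rad_edge] balance. The equation is linear in [t] with
    slope 2, so an edge has at most one peak. *)
Definition peak e t := t + rad (GV (src e)) = len e - t + rad (GV (tgt e)).

Lemma pt_ball_len_rad e s r : valid (@GE _ g e s) -> 0 <= r <= rad (GE e s) ->
  length_of (gball (GE e s) r) = (r *+ 2)%:E.
Proof.
move=> vs hr; rewrite length_gball_edge //; last by case/andP: hr.
have [[v nv E] hmin] := radP (GE e s); congr EFin.
have dE u : gdist (GE e s) (GV u) = pt_dist e s u by exact: gdist_edge_vertex.
apply: (@pt_ball_len_below R _ _ src tgt len vdist) nv _ _ => //; first exact: len_gt0.
- exact: loopless.
- exact: vdist_ge0.
- exact: vdistxx.
- exact: vdist_lip.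
- exact: vdist_incoming.
- by move=> u /hmin; rewrite E !dE.
- by rewrite -dE -E.
Qed.

(** Off the peak one branch of [rad_edge] is strictly smaller, so no nearest node is reached at
    distance [rad] through the other end: this is the strict alternative of
    [pt_ball_len_off_peak]. *)
Lemma pt_ball_len_not_peak e s eta : valid (@GE _ g e s) -> ~ peak e s -> 0 < eta ->
  exists2 r, rad (GE e s) < r < rad (GE e s) + eta &
    length_of (gball (GE e s) r) <> (r *+ 2)%:E.
Proof.
move=> vs npk eta0.
have [[v nv E] hmin] := radP (GE e s).
have dE u : gdist (GE e s) (GV u) = pt_dist e s u by exact: gdist_edge_vertex.
have [r hr hne] : exists2 r, pt_dist e s v < r < pt_dist e s v + eta &
    pt_ball_len src tgt len vdist e s r != r *+ 2.
  apply: pt_ball_len_off_peak => //; first exact: len_gt0.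
  - exact: loopless.
  - exact: vdist_ge0.
  - exact: vdistxx.
  - exact: vdist_lip.
  - exact: vdist_incoming.
  - by move=> u /hmin; rewrite E !dE.
  rewrite -dE -E; move: (rad_edge vs) => RE.
  have hs u : node u -> rad (GV (src e)) <= vdist (src e) u.
    by move=> /(rad_le (GV (src e))); rewrite gdist_vertices.
  have ht u : node u -> rad (GV (tgt e)) <= vdist (tgt e) u.
    by move=> /(rad_le (GV (tgt e))); rewrite gdist_vertices.
  move: npk RE; rewrite /peak; case: ltgtP => // h _ ->.
    by right=> u /ht; lra.
  by left=> u /hs; lra.
rewrite -dE -E in hr; exists r => //.
rewrite length_gball_edge //; last first.
  by move: hr; rewrite E; move: (@gdist_ge0 _ _ hg (GE e s) (GV v) vs I); lra.
by move=> [] /eqP; rewrite (negbTE hne).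
Qed.

(* [rad] has slope 1 or -1 along every germ of an edge. *)
Lemma rad_local y : valid y -> exists2 eps : R, 0 < eps &
  forall z, valid z -> gdist y z < eps -> gdist y z = `|rad z - rad y|.
Proof.
have [eps1 eps10 [hl hd]] := vdist_separated.
case: y => [v _|f t vt].
  (* These quantities are nonnegative because [rad] is 1-Lipschitz. If positive, [rad] increases
     along the edge away from [v]; if zero, it decreases. The gaps [e2] and [e3] make the first case
     uniform. *)
  have [e2 e20 he2] := fin_pos_min (fun e => len e + rad (GV (tgt e)) - rad (GV (src e))).
  have [e3 e30 he3] := fin_pos_min (fun e => len e + rad (GV (src e)) - rad (GV (tgt e))).
  pose eps := Num.min eps1 (Num.min e2 e3) / 2.
  have m0 : 0 < Num.min eps1 (Num.min e2 e3) by rewrite !lt_min eps10 e20 e30.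
  have [l1 l2 l3] : [/\ Num.min eps1 (Num.min e2 e3) <= eps1,
      Num.min eps1 (Num.min e2 e3) <= e2 & Num.min eps1 (Num.min e2 e3) <= e3].
    by rewrite !ge_min !lexx !orbT.
  have {m0 l1 l2 l3} [h0 h1 h2 h3] : [/\ 0 < eps, eps *+ 2 <= eps1, eps *+ 2 <= e2 & eps *+ 2 <= e3].
    by rewrite /eps; split; lra.
  exists eps => // -[w _|e t vt].
    rewrite gdist_vertices //; case: (eqVneq v w) => [<- _|/hd]; last by lra.
    by rewrite vdistxx // subrr normr0.
  have /andP [t0 t1] := vt.
  have far u : vdist v u < eps -> u = v.
    by move=> h; apply/eqP; rewrite eq_sym; apply: contraTT h => /hd ?; rewrite -leNgt; lra.
  have d1 := vdist_ge0 hg v (src e); have d2 := vdist_ge0 hg v (tgt e).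
  have le1 := hl e; have nl := loopless hg e.
  have L1 := @rad_lip (GV (src e)) (GV (tgt e)) I I.
  have L2 := @rad_lip (GV (tgt e)) (GV (src e)) I I.
  rewrite !gdist_vertices // (vdistC hg (tgt e)) in L1 L2.
  have ve := vdist_edge hg e.
  rewrite gdist_vertex_edge // rad_edge //; case: (leP (vdist v (src e) + t)) => hle hlt.
    have E : src e = v by apply: far; lra.
    rewrite -E vdistxx // add0r in hlt *; rewrite -E vdistxx // in hle.
    have := he2 e; case: (ltrP 0 (len e + rad (GV (tgt e)) - rad (GV (src e)))) => [h /(_ isT) h'|h _].
      by rewrite min_l; [rewrite addrK ger0_norm // ltW | lra].
    rewrite min_r; last by lra.
    by rewrite ler0_norm; lra.
  have E : tgt e = v by apply: far; lra.
  rewrite -E vdistxx // add0r in hlt *; rewrite -E vdistxx // in hle.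
  have := he3 e; case: (ltrP 0 (len e + rad (GV (src e)) - rad (GV (tgt e)))) => [h /(_ isT) h'|h _].
    by rewrite min_r; [rewrite addrK ger0_norm // subr_ge0 ltW | lra].
  rewrite min_l; last by lra.
  by rewrite ler0_norm; lra.
have /andP [t0 t1] := vt.
set A := t + rad (GV (src f)); set B := len f - t + rad (GV (tgt f)).
have [eps eps0 [h1 h2 h3]] : exists2 eps : R, 0 < eps &
    [/\ eps <= t, eps <= len f - t & A != B -> eps *+ 2 <= `|A - B|].
  have m0 : 0 < Num.min t (len f - t) by rewrite lt_min t0 subr_gt0.
  have [l1 l2] : Num.min t (len f - t) <= t /\ Num.min t (len f - t) <= len f - t.
    by rewrite !ge_min !lexx !orbT.
  case: (eqVneq A B) => [AB|AB]; first by exists (Num.min t (len f - t)).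
  have n0 : 0 < `|A - B| / 2 by rewrite divr_gt0 // normr_gt0 subr_eq0.
  exists (Num.min (Num.min t (len f - t)) (`|A - B| / 2)); first by rewrite lt_min m0 n0.
  split=> [||_]; try by rewrite ge_min ?l1 ?l2.
  have : Num.min (Num.min t (len f - t)) (`|A - B| / 2) <= `|A - B| / 2 by rewrite ge_min lexx orbT.
  lra.
have big v : eps <= pt_dist f t v by case: (pt_dist_ge v vt); lra.
exists eps => // -[w _|e q vq].
  by rewrite gdist_edge_vertex // ltNge big.
have /andP [q0 q1] := vq.
case: (eqVneq f e) vq q1 => [<- vq q1|fe vq q1]; last first.
  rewrite gdist_edges // => h; exfalso; move: h; apply/negP; rewrite -leNgt le_min.
  by apply/andP; split; [move: (big (src e))|move: (big (tgt e))]; lra.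
have E : gdist (GE f t) (GE f q) < eps -> gdist (GE f t) (GE f q) = `|t - q|.
  rewrite gdist_edge // => h; rewrite min_l //.
  move: h; rewrite !gt_min le_min => /orP [h|]; last first.
    by case/orP=> h; exfalso; [move: (big (src f))|move: (big (tgt f))]; lra.
  by apply/andP; split; [move: (big (src f))|move: (big (tgt f))]; lra.
move=> /[dup] /E -> h; rewrite !rad_edge // -/A -/B.
have -> : q + rad (GV (src f)) = A + (q - t) by rewrite /A; lra.
have -> : len f - q + rad (GV (tgt f)) = B - (q - t) by rewrite /B; lra.
rewrite distrC in h *; move: (q - t) h => d h.
(* At a peak the minimum of [A + d] and [A - d] is [A - |d|], of slope -1 in both directions;
   elsewhere one branch prevails for small [d]. *)
case: (eqVneq A B) h3 => [-> _|AB /(_ isT)].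
  rewrite minxx; case: (leP 0 d) => d0.
    by rewrite min_r; [rewrite (ger0_norm d0) ler0_norm; lra | lra].
  by rewrite min_l; [congr (`|_|); lra | lra].
move: h; rewrite ltr_norml => /andP [d1 d2].
case: (leP A B) => lAB.
  rewrite ler0_norm ?subr_le0 // => h3; rewrite min_l; [congr (`|_|); lra | lra].
rewrite gtr0_norm ?subr_gt0 // => h3; rewrite min_r; last by lra.
by rewrite -normrN; congr (`|_|); lra.
Qed.

End Small.

(** * Maps preserving the local distance distributions *)

(* Real induction. *)
Lemma locally_short_is_short (R : realType) (d : R -> R -> R) (s t : R) : s <= t ->
  (forall x y z, d x z <= d x y + d y z) -> d s s <= 0 ->
  (forall r, s <= r <= t -> exists2 eta : R, 0 < eta &
     forall r', s <= r' <= t -> `|r - r'| < eta -> d r r' <= `|r - r'| /\ d r' r <= `|r - r'|) ->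
  d s t <= t - s.
Proof.
move=> st tri dss loc.
pose A : set R := [set r | s <= r <= t /\ d s r <= r - s].
have As : A s by split; [rewrite lexx | rewrite subrr].
have supA : has_sup A by split; [exists s | exists t => r [/andP []]].
pose c := sup A.
have sc : s <= c by exact: (ub_le_sup (proj2 supA)).
have ct : c <= t by apply: ge_sup; [exists s | move=> r [/andP []]].
have [eta eta0 heta] : exists2 eta : R, 0 < eta & forall r', s <= r' <= t -> `|c - r'| < eta ->
    d c r' <= `|c - r'| /\ d r' c <= `|c - r'| by apply: loc; rewrite sc.
have Ac : A c.
  split; first by rewrite sc.
  have [r [rst dr] cr] := sup_adherent eta0 supA.
  have rc : r <= c by apply: (ub_le_sup (proj2 supA)).
  have cr' : c - eta < r by [].
  have hcr : `|c - r| < eta by rewrite ger0_norm ?subr_ge0 //; lra.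
  have [_ h] := heta r rst hcr; rewrite ger0_norm ?subr_ge0 // in h.
  by have := tri s r c; lra.
have [tc|tc] := leP t c.
  by have <- : c = t; [apply/eqP; rewrite eq_le ct | case: Ac].
pose r := Num.min t (c + eta / 2).
have cr : c < r by rewrite lt_min tc /=; lra.
have rt : r <= t by rewrite ge_min lexx.
have re : r <= c + eta / 2 by rewrite ge_min lexx orbT.
have : A r.
  split; first by rewrite rt andbT; lra.
  have hcr : `|c - r| < eta by rewrite distrC gtr0_norm ?subr_gt0 //; lra.
  have [|h _] := heta r _ hcr; first by rewrite rt andbT; lra.
  rewrite distrC gtr0_norm ?subr_gt0 // in h; case: Ac => _ h'.
  by have := tri s c r; lra.
by move=> /(ub_le_sup (proj2 supA)); rewrite leNgt cr.
Qed.

Section Main.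
Variables (R : realType) (G H : mgraph R).
Hypotheses (hG : is_mgraph G) (hH : is_mgraph H).
Variable phi : gpt G -> gpt H.
Hypothesis phi_into : forall x, valid x -> valid (phi x).
Hypothesis phi_cont : forall x, valid x -> forall eps : R, 0 < eps ->
  exists2 delta : R, 0 < delta &
    forall y, valid y -> gdist x y < delta -> gdist (phi x) (phi y) < eps.
Hypothesis phi_push : forall B, mg_measurable B -> mg_measure (phi @^-1` B) = mg_measure B.
Hypothesis phi_h : forall x, valid x -> forall r : R, 0 <= r -> hdist x r = hdist (phi x) r.
Variable vG : 'I_(mg_nv G).
Hypothesis node_vG : node vG.

(** While the total lengths of the two graphs are not yet compared, preservation of normalised
    measures only transfers null sets of lengths. *)
Lemma length_preim0 B : mg_measurable B -> length_of B = 0%E -> length_of (phi @^-1` B) = 0%E.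
Proof.
move=> mB B0; have := phi_push mB; rewrite /mg_measure -!/(length_of _) B0 mul0e => /eqP.
rewrite mule_eq0 => /orP [/eqP //|]; rewrite eqe invr_eq0 => /eqP h.
by have := total_len_gt0 hG; rewrite h ltxx.
Qed.

Lemma avoid_null B e (s t : R) : mg_measurable B -> length_of B = 0%E ->
  0 <= s -> s < t -> t <= mg_len e -> exists q, s < q < t /\ ~ B (phi (GE e q)).
Proof.
move=> mB B0 s0 st te; apply: contrapT => hn.
have : (0 < length_of (phi @^-1` B))%E.
  apply: (length_gt0 s0 st te) => q hq /=.
  by apply: contrapT => hB; apply: hn; exists q.
by rewrite length_preim0 ?ltxx.
Qed.

Definition vertices : set (gpt H) := [set y | exists v, y = GV v].

Lemma slice_vertices e : edge_slice vertices e = set0.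
Proof. by apply/seteqP; split=> t //= -[_ [v]]. Qed.

(** Some interior point of an edge has an image interior to an edge, because the vertices form a
    null set. Small balls around both have length [2 r], so the normalising constants agree. *)
Lemma total_eq : total_len G = total_len H.
Proof.
have [ne0 _ _ _ _] := hG; pose e0 := Ordinal ne0 : 'I_(mg_ne G).
have [||q [/andP [q0 q1]]] := @avoid_null vertices e0 0 (mg_len e0) _ _ (lexx _) (len_gt0 hG _) (lexx _).
- by move=> e; rewrite slice_vertices; exact: measurable0.
- by rewrite /length_of big1 // => e _; rewrite slice_vertices measure0.
have vq : valid (GE e0 q) by apply/andP.
have := phi_into vq; have := phi_h vq; case: (phi (GE e0 q)) => [v _ _ []|f t hh vt _]; first by exists v.
have [e1 e10 h1] := length_gball_edge_small hG vq.
have [e2 e20 h2] := length_gball_edge_small hH vt.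
pose r := Num.min e1 e2; have r0 : 0 < r by rewrite lt_min e10.
have r1 : 0 <= r <= e1 by rewrite ltW //= ge_min lexx.
have r2 : 0 <= r <= e2 by rewrite ltW //= ge_min lexx orbT.
have := hh r (ltW r0); rewrite !hdistE h1 // h2 // => -[].
have := total_len_gt0 hG; have := total_len_gt0 hH => g0 g1 /mulfI.
by rewrite mulrn_eq0 /= => /(_ (lt0r_neq0 r0)) /invr_inj.
Qed.

Lemma length_phi x r : valid x -> 0 <= r -> length_of (gball x r) = length_of (gball (phi x) r).
Proof.
move=> vx r0; have := phi_h vx r0; rewrite !hdistE total_eq.
have [l ->] := length_gball_fin hG vx r0; have [l' ->] := length_gball_fin hH (phi_into vx) r0.
move=> [] /mulIf ->//; rewrite invr_eq0 gt_eqF // total_len_gt0 //.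
Qed.

Lemma length_preim B : mg_measurable B -> length_of (phi @^-1` B) = length_of B.
Proof.
move=> mB; have := phi_push mB; rewrite /mg_measure -!/(length_of _) total_eq.
have L := total_len_gt0 hH; set c := ((total_len H)^-1)%:E => E.
have cc : (c * (total_len H)%:E = 1)%E by rewrite -EFinM mulVf ?gt_eqF.
by rewrite -[LHS]mule1 -[RHS]mule1 -cc !muleA E.
Qed.

(** Small balls around [vG] grow at a rate other than 2, so its image is neither inside an edge nor
    a vertex of degree 2. *)
Lemma exists_node : exists wH : 'I_(mg_nv H), node wH.
Proof.
have [e1 e10 h1] := length_gball_vertex_small hG vG.
have E := @length_phi (GV vG) _ I; have := phi_into (I : valid (GV vG)).
case: (phi (GV vG)) E => [w|f t] E vw.
  exists w; have [e2 e20 h2] := length_gball_vertex_small hH w.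
  pose r := Num.min e1 e2; have r0 : 0 < r by rewrite lt_min e10.
  have r1 : 0 <= r <= e1 by rewrite ltW //= ge_min lexx.
  have r2 : 0 <= r <= e2 by rewrite ltW //= ge_min lexx orbT.
  have := E r (ltW r0); rewrite h1 // h2 // => -[].
  rewrite -!(mulr_natr r) => /(mulfI (lt0r_neq0 r0)) /eqP; rewrite eqr_nat => /eqP deg.
  by rewrite /node -deg; exact: node_vG.
have [e2 e20 h2] := length_gball_edge_small hH vw.
pose r := Num.min e1 e2; have r0 : 0 < r by rewrite lt_min e10.
have r1 : 0 <= r <= e1 by rewrite ltW //= ge_min lexx.
have r2 : 0 <= r <= e2 by rewrite ltW //= ge_min lexx orbT.
have := E r (ltW r0); rewrite h1 // h2 // => -[].
rewrite -!(mulr_natr r) => /(mulfI (lt0r_neq0 r0)) /eqP; rewrite eqr_nat => /eqP deg.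
by move: node_vG; rewrite /node deg.
Qed.

(** * Equality of the radius functions, and the isometry *)

Section Isometry.
Variables (radG : gpt G -> R) (radH : gpt H -> R).
Hypotheses (radGP : node_dist radG) (radHP : node_dist radH).

Definition vertices_and_peaks : set (gpt H) := [set y | if y is GE e t then peak radH e t else True].

Lemma slice_vertices_and_peaks e : edge_slice vertices_and_peaks e `<=`
  [set (mg_len e + radH (GV (mg_tgt e)) - radH (GV (mg_src e))) / 2].
Proof. by move=> t /= [_]; rewrite /vertices_and_peaks /= /peak => h; lra. Qed.

Lemma measurable_vertices_and_peaks : mg_measurable vertices_and_peaks.
Proof.
move=> e; have := @slice_vertices_and_peaks e; set c := (_ / 2) => hs.
case: (pselect (edge_slice vertices_and_peaks e c)) => h.
  have -> : edge_slice vertices_and_peaks e = [set c] by apply/seteqP; split=> // t ->.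
  exact: measurable_set1.
have -> : edge_slice vertices_and_peaks e = set0.
  by apply/seteqP; split=> // t ht; apply: h; rewrite -(hs t ht).
exact: measurable0.
Qed.

Lemma length_vertices_and_peaks : length_of vertices_and_peaks = 0%E.
Proof.
rewrite /length_of big1 // => e _; apply/eqP; rewrite eq_le lebesgue_ge0 andbT.
by rewrite (le_trans (le_lebesgue (@slice_vertices_and_peaks e))) // lebesgue_measure_set1.
Qed.

(** Balls have length [2 r] up to [rad] and differ from it at radii arbitrarily close beyond.
    Corresponding balls have equal lengths, so neither radius can be the smaller. *)
Lemma rad_phi_generic e q f t : valid (GE e q) -> valid (GE f t) -> phi (GE e q) = GE f t ->
  ~ peak radG e q -> ~ peak radH f t -> radG (GE e q) = radH (GE f t).
Proof.
move=> vq vt E nG nH.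
have EL r : 0 <= r -> length_of (gball (GE e q) r) = length_of (gball (GE f t) r).
  by rewrite -E; exact: length_phi.
have rG0 := rad_ge0 hG radGP vq.
have rH0 := rad_ge0 hH radHP vt.
case: (ltgtP (radG (GE e q)) (radH (GE f t))) => // h; exfalso.
  have d0 : 0 < radH (GE f t) - radG (GE e q) by rewrite subr_gt0.
  have [r /andP [r1 r2]] := pt_ball_len_not_peak hG radGP vq nG d0.
  rewrite EL; last by lra.
  by apply; apply: (pt_ball_len_rad hH radHP) => //; apply/andP; split; lra.
have d0 : 0 < radG (GE e q) - radH (GE f t) by rewrite subr_gt0.
have [r /andP [r1 r2]] := pt_ball_len_not_peak hH radHP vt nH d0.
rewrite -EL; last by lra.
by apply; apply: (pt_ball_len_rad hG radGP) => //; apply/andP; split; lra.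
Qed.

Lemma rad_phi x : valid x -> radG x = radH (phi x).
Proof.
move=> vx; apply/eqP; rewrite -subr_eq0 -normr_eq0; apply: contraT => hne.
have {hne} d0 : 0 < `|radG x - radH (phi x)| by rewrite lt_neqAle eq_sym hne normr_ge0.
set d := `|_ - _| in d0.
have d20 : 0 < d / 2 by lra.
have [dl dl0 hdl] := phi_cont vx d20.
have r0 : 0 < Num.min dl (d / 2) by rewrite lt_min dl0.
have [e [s [t [s0 st te hb]]]] := edge_in_gball hG vx r0.
pose c := (mg_len e + radG (GV (mg_tgt e)) - radG (GV (mg_src e))) / 2.
(* The interval from [s] to [m] misses the only possible peak [c] of [e]. *)
pose m := if s < c < t then c else t.
have sm : s < m by rewrite /m; case: ifP => // /andP [].
have mt : m <= t by rewrite /m; case: ifP => // /andP [_ /ltW].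
have [q [/andP [q0 q1] hq]] := avoid_null measurable_vertices_and_peaks length_vertices_and_peaks s0 sm (le_trans mt te).
have vq : valid (GE e q) by apply/andP; split; lra.
have qt : s < q < t by apply/andP; split; lra.
have npk : ~ peak radG e q.
  rewrite /peak => h; have qc : q = c by rewrite /c; lra.
  by move: q1; rewrite /m -qc qt ltxx.
have := hb q qt; rewrite lt_min => /andP [b1 b2].
have := hdl _ vq b1; have := rad_dist hG radGP vx vq.
have := rad_dist hH radHP (phi_into vx) (phi_into vq).
have -> : radG (GE e q) = radH (phi (GE e q)).
  move: (phi_into vq) hq (@rad_phi_generic e q).
  case: (phi (GE e q)) => [v _ []//|f u vu npk' h].
  by apply: h.
rewrite !ler_norml => /andP [h1 h2] /andP [h3 h4] h5.
have : d < d by rewrite {1}/d ltr_norml; apply/andP; split; lra.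
by rewrite ltxx.
Qed.

(** Near [phi x] the distance in [H] is the variation of [radH], which equals that of [radG], a
    1-Lipschitz function. *)
Lemma phi_local x : valid x -> exists2 eta : R, 0 < eta &
  forall z, valid z -> gdist x z < eta -> gdist (phi x) (phi z) <= gdist x z.
Proof.
move=> vx; have [eps eps0 heps] := rad_local hH radHP (phi_into vx).
have [eta eta0 heta] := phi_cont vx eps0.
exists eta => // z vz xz; rewrite heps; [|exact: phi_into|exact: heta].
by rewrite -!rad_phi // distrC rad_dist.
Qed.

Lemma phi_onedge e (s t : R) : 0 <= s <= mg_len e -> 0 <= t <= mg_len e ->
  gdist (phi (onedge e s)) (phi (onedge e t)) <= `|s - t|.
Proof.
wlog st : s t / s <= t.
  move=> W hs ht; case: (leP s t) => [st|/ltW st]; first exact: W.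
  by rewrite gdistC // distrC W.
move=> /andP [s0 s1] /andP [t0 t1]; rewrite distrC (ger0_norm (_ : 0 <= t - s)) ?subr_ge0 //.
pose d s t := gdist (phi (onedge e s)) (phi (onedge e t)).
have vo r : valid (onedge e r) by exact: valid_onedge.
apply: (locally_short_is_short (d := d)) => //.
- by move=> x y z; apply: gdist_tri => //; exact: phi_into.
- by rewrite /d gdistxx //; exact: phi_into.
move=> r /andP [r0 r1]; have [eta eta0 heta] := phi_local (vo r); exists eta => // r' /andP [r2 r3] h.
have le : gdist (onedge e r) (onedge e r') <= `|r - r'|.
  by apply: gdist_onedge => //; apply/andP; split; lra.
have D := heta _ (vo r') (le_lt_trans le h).
by split; rewrite /d; [|rewrite gdistC //]; exact: le_trans D le.
Qed.

Lemma loc_onedgeE (x : gpt G) e s : valid x -> loc x e s -> x = onedge e s.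
Proof.
case: x => [v _ [] [-> ->]|f t vt [<- ->]].
- by rewrite onedge0.
- by rewrite onedge_len.
- by rewrite onedge_in.
Qed.

(** The pullback of the distance of [H] is a pseudometric dominated by arclength on every edge, so
    maximality of [gdist] applies. *)
Lemma phi_lip x y : valid x -> valid y -> gdist (phi x) (phi y) <= gdist x y.
Proof.
move: x y; apply: (gdist_maximal hG (D := fun x y => gdist (phi x) (phi y))) => //.
- by move=> x vx; rewrite gdistxx //; exact: phi_into.
- by move=> x y z vx vy vz; apply: gdist_tri => //; exact: phi_into.
move=> x y e s t vx vy hs ht.
by rewrite (loc_onedgeE vx hs) (loc_onedgeE vy ht) phi_onedge ?(loc_le hG vx hs) ?(loc_le hG vy ht).
Qed.

(* Were two points brought closer together, the preimage of a ball around the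
   image of one of them would contain a ball of the same mass and, disjoint
   from it, a small ball around the other. *)
Lemma phi_isometry x y : valid x -> valid y -> gdist (phi x) (phi y) = gdist x y.
Proof.
move=> vx vy; apply/eqP; rewrite eq_le phi_lip //= leNgt; apply/negP => h.
(* With a third of the defect, the radii [r] and [eta] add up to less than [gdist x y], which keeps
   the two balls disjoint. *)
pose eta := (gdist x y - gdist (phi x) (phi y)) / 3.
have eta0 : 0 < eta by rewrite /eta; lra.
have d0 : 0 <= gdist (phi x) (phi y) by apply: gdist_ge0 => //; exact: phi_into.
pose r := gdist (phi x) (phi y) + eta.
have r0 : 0 <= r by rewrite /r; lra.
have mB : mg_measurable (gball (phi x) r) by apply: measurable_gball => //; exact: phi_into.
have := @length_disjoint _ G (gball x r) (gball y eta) (phi @^-1` gball (phi x) r).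
rewrite length_preim // -length_phi //.
have [l El] := length_gball_fin hG vx r0; rewrite El.
have pos := gball_gt0 hG vy eta0; have [l' El'] := length_gball_fin hG vy (ltW eta0).
rewrite El' in pos *; rewrite lte_fin in pos.
move=> D; suff : (l%:E + l'%:E <= l%:E)%E by rewrite -EFinD lee_fin; lra.
apply: D.
- exact: measurable_gball.
- by apply: measurable_gball => //; exact: ltW.
- move=> z vz [_ h1] [_ h2]; have := gdist_tri hG vx vz vy.
  by rewrite (gdistC z y); move: h1 h2; rewrite /r /eta; lra.
move=> z vz hz; split; first exact: phi_into.
case: hz => -[_ hz]; first by rewrite (le_trans (phi_lip _ _)).
have := gdist_tri hH (phi_into vx) (phi_into vy) (phi_into vz).
by have := phi_lip vy vz; rewrite /r; lra.
Qed.

(** The image of each closed edge is compact, so a missed point has positive distance to the whole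
    image; a ball of half that radius would have positive length but an empty preimage on every
    edge. *)
Lemma phi_surj y : valid y -> exists x, valid x /\ phi x = y.
Proof.
move=> vy; apply: contrapT => hn.
have pos x : valid x -> 0 < gdist (phi x) y.
  move=> vx; rewrite ltNge; apply/negP => h; apply: hn; exists x; split=> //.
  by apply: (gdist_eq0 hH) => //; exact: phi_into.
have hmin e : exists2 m : R, 0 < m & forall t, 0 <= t <= mg_len e -> m <= gdist (phi (onedge e t)) y.
  (* Precomposing with the 1-Lipschitz retraction onto the edge interval gives a function continuous
     on all of R, to which the extreme value theorem applies. *)
  pose clip (t : R) := Num.max 0 (Num.min t (mg_len e)).
  have l0 := ltW (len_gt0 hG e).
  have clipI t : 0 <= clip t <= mg_len e by rewrite le_max lexx ge_max l0 ge_min lexx orbT.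
  have clip_id t : 0 <= t <= mg_len e -> clip t = t.
    by move=> /andP [t0 t1]; rewrite /clip min_l // max_r.
  have clip_lip s t : `|clip s - clip t| <= `|s - t|.
    have key u v : u <= v -> clip u <= clip v /\ clip v - clip u <= v - u.
      rewrite /clip => uv; case: (leP u (mg_len e)) => ?; case: (leP v (mg_len e)) => ?;
      rewrite ?(max_r l0); case: (leP 0 u) => ?; case: (leP 0 v) => ?; split; lra.
    case: (leP s t) => [st|/ltW st]; last rewrite distrC [leRHS]distrC.
      rewrite ler0_norm ?ler0_norm ?subr_le0 //; have [] := key _ _ st; lra.
    rewrite ler0_norm ?ler0_norm ?subr_le0 //; have [] := key _ _ st; lra.
  pose f t := gdist (phi (onedge e (clip t))) y.
  have vo t : valid (phi (onedge e t)) by apply/phi_into/valid_onedge.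
  have flip s t : `|f s - f t| <= `|s - t|.
    apply: le_trans (clip_lip s t); apply: le_trans (phi_onedge (clipI s) (clipI t)).
    rewrite ler_distlC /f; have := gdist_tri hH (vo (clip s)) (vo (clip t)) vy.
    have := gdist_tri hH (vo (clip t)) (vo (clip s)) vy.
    by rewrite (gdistC (phi (onedge e (clip t))) (phi (onedge e (clip s)))) => ? ?; apply/andP; split; lra.
  have fc : continuous f.
    move=> t; apply/cvgrPdist_lt => eps eps0; near=> s.
    apply: le_lt_trans (flip t s) _; near: s.
    by apply/nbhs_ballP; exists eps.
  have [c _ hc] := @EVT_min R f 0 (mg_len e) l0 (continuous_subspaceT fc).
  exists (f c); first by apply/pos/valid_onedge.
  by move=> t ht; have := hc t; rewrite in_itv /= => /(_ ht); rewrite /f (clip_id t).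
have [m m0 hm] : exists2 m : R, 0 < m & forall x, valid x -> m <= gdist (phi x) y.
  pose M e := projT1 (cid2 (hmin e)).
  have MP e : 0 < M e /\ forall t, 0 <= t <= mg_len e -> M e <= gdist (phi (onedge e t)) y.
    by rewrite /M; case: cid2.
  have [m m0 hm] := fin_pos_min M; exists m => // x /(onedgeP hG) [e [t [ht ->]]].
  by case: (MP e) => M0 /(_ t ht); apply: le_trans; exact: hm.
have m20 : 0 < m / 2 by lra.
have : length_of (phi @^-1` gball y (m / 2)) = length_of (gball y (m / 2)).
  by apply: length_preim; apply: measurable_gball => //; exact: ltW.
have -> : length_of (phi @^-1` gball y (m / 2)) = 0%E.
  rewrite /length_of big1 // => e _.
  have -> : edge_slice (phi @^-1` gball y (m / 2)) e = set0; last by rewrite measure0.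
  apply/seteqP; split=> t //= -[vt [_]]; have := hm (GE e t) vt.
  by rewrite (gdistC y); lra.
by move=> E; have := gball_gt0 hH vy m20; rewrite -E ltxx.
Unshelve. all: by end_near.
Qed.

End Isometry.

Lemma mm_iso_of_node : mm_iso phi.
Proof.
have [wH nwH] := exists_node.
have [radG radGP] := exists_node_dist node_vG; have [radH radHP] := exists_node_dist nwH.
split=> //.
- move=> x y vx vy E; apply: (gdist_eq0 hG) => //.
  by rewrite -(phi_isometry radGP radHP) // E gdistxx //; exact: phi_into.
- exact: (phi_surj radGP radHP).
- exact: (phi_isometry radGP radHP).
Qed.

End Main.

(** * Circles *)

Section Isometries.
Variable R : realType.

(** The pushforward of Lebesgue measure by [f] is a measure, and agreement on half-open intervals
    determines it. *)
Lemma lebesgue_preimage (f : R -> R) : measurable_fun [set: R] f ->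
  (forall a b, lebesgue_measure (f @^-1` `]a, b]%classic) = lebesgue_measure `]a, b]%classic) ->
  forall A, measurable A -> lebesgue_measure (f @^-1` A) = lebesgue_measure A.
Proof.
move=> mf h A mA; apply/esym.
pose mu := measure_function_pushforward__canonical__measure_function_Measure
  (lebesgue_measure : {measure set (measurableTypeR R) -> \bar R}) (mf : measurable_fun (T := measurableTypeR R) (U := measurableTypeR R) _ f).
apply: (lebesgue_measure_unique (mu := mu)) mA => X [[a b] _ <-].
by rewrite -h.
Qed.

Lemma lebesgue_shift (c : R) A : measurable A ->
  lebesgue_measure [set t | A (c + t)] = lebesgue_measure A.
Proof.
apply: (@lebesgue_preimage (fun t => c + t)); first exact: measurable_realfun.measurable_funD.
move=> a b; have -> : (fun t => c + t) @^-1` `]a, b]%classic = `]a - c, b - c]%classic.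
  by apply/seteqP; split=> t /=; rewrite !in_itv /= => /andP [? ?]; apply/andP; split; lra.
rewrite !lebesgue_measure_itv /= !lte_fin ltrD2r; case: ifP => // _.
by rewrite -!EFinB; congr EFin; lra.
Qed.

Lemma lebesgue_reflection (c : R) A : measurable A ->
  lebesgue_measure [set t | A (c - t)] = lebesgue_measure A.
Proof.
apply: (@lebesgue_preimage (fun t => c - t)); first exact: measurable_realfun.measurable_funB.
move=> a b; have -> : (fun t => c - t) @^-1` `]a, b]%classic = `[c - b, c - a[%classic.
  by apply/seteqP; split=> t /=; rewrite !in_itv /= => /andP [? ?]; apply/andP; split; lra.
rewrite !lebesgue_measure_itv /= !lte_fin ltrD2l ltrN2; case: ifP => // _.
by rewrite -!EFinB; congr EFin; lra.
Qed.

Lemma circ_distC (c s t : R) : circ_dist c s t = circ_dist c t s.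
Proof. by rewrite /circ_dist distrC. Qed.

Lemma circ_dist_tri (c r s t : R) : 0 <= r < c -> 0 <= s < c -> 0 <= t < c ->
  circ_dist c r t <= circ_dist c r s + circ_dist c s t.
Proof.
rewrite /circ_dist => /andP [? ?] /andP [? ?] /andP [? ?].
case: (ler0P (r - s)) => ?; case: (ler0P (s - t)) => ?; case: (ler0P (r - t)) => ?;
case: (leP (_ : R) (c - _)) => ?; case: (leP (_ : R) (c - _)) => ?; case: (leP (_ : R) (c - _)) => ?; lra.
Qed.

End Isometries.

(** * Non-backtracking walks in graphs where every vertex has degree 2 *)

Section TwoRegular.
Variables (R : realType) (g : mgraph R).
Hypothesis hg : is_mgraph g.
Local Notation nv := (mg_nv g).
Local Notation ne := (mg_ne g).
Local Notation src := (@mg_src _ g).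
Local Notation tgt := (@mg_tgt _ g).
Local Notation len := (@mg_len _ g).
Hypothesis deg2 : forall v, degree src tgt v = 2.
Implicit Types (u v : 'I_nv) (e f : 'I_ne) (x y z : gpt g).

Local Notation dart := ('I_ne * bool)%type.
Implicit Types p q : dart.

Definition dtail p := if p.2 then src p.1 else tgt p.1.
Definition dhead p := if p.2 then tgt p.1 else src p.1.
Definition drev p : dart := (p.1, ~~ p.2).
(** Leave the head of [p] by its other edge. The default [p] never occurs, by [dnextP]. *)
Definition dnext p := odflt p [pick q | (dtail q == dhead p) && (q.1 != p.1)].

Lemma incident_dtail p : incident src tgt (dtail p) p.1.
Proof. by rewrite /incident /dtail; case: p.2; rewrite eqxx ?orbT. Qed.

Lemma incident_dhead p : incident src tgt (dhead p) p.1.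
Proof. by rewrite /incident /dhead; case: p.2; rewrite eqxx ?orbT. Qed.

Lemma incident_dart v e : incident src tgt v e -> exists b, dtail (e, b) = v.
Proof. by case/orP=> /eqP <-; [exists true | exists false]. Qed.

Lemma incident2 v e1 e2 e : e1 != e2 -> incident src tgt v e1 -> incident src tgt v e2 ->
  incident src tgt v e -> e = e1 \/ e = e2.
Proof.
move=> ne12 h1 h2 h.
have E : [set e1; e2]%SET = [set e | incident src tgt v e]%SET.
  apply/eqP; rewrite eqEcard; apply/andP; split.
    by apply/fintype.subsetP => f; rewrite !inE => /orP [] /eqP ->.
  by rewrite cards2 ne12 -/(degree src tgt v) deg2.
have : e \in [set e1; e2]%SET by rewrite E inE.
by rewrite !inE => /orP [] /eqP; [left|right].
Qed.

Lemma dtail_inj p q : dtail p = dtail q -> p.1 = q.1 -> p = q.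
Proof.
case: p q => [e b] [f b'] /= + ef; rewrite -ef /dtail /=.
case: b b' => [] [] //= h; have := loopless hg e; rewrite h eqxx //.
Qed.

Lemma dtail_drev p : dtail (drev p) = dhead p.
Proof. by rewrite /dtail /dhead /=; case: p.2. Qed.

Lemma dhead_drev p : dhead (drev p) = dtail p.
Proof. by rewrite /dtail /dhead /=; case: p.2. Qed.

Lemma dnextP p : dtail (dnext p) = dhead p /\ (dnext p).1 != p.1.
Proof.
rewrite /dnext; case: pickP => [q /andP [/eqP -> ->] //|none]; exfalso.
have : (1 < #|[set e | incident src tgt (dhead p) e]%SET|)%N.
  by rewrite -/(degree src tgt (dhead p)) deg2.
rewrite (cardsD1 p.1) inE incident_dhead /= ltnS card_gt0 => /finset.set0Pn [e].
rewrite !inE => /andP [ep /incident_dart [b hb]].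
by have := none (e, b); rewrite hb eqxx /= ep.
Qed.

Lemma dnext_uniq p q : dtail q = dhead p -> q.1 != p.1 -> q = dnext p.
Proof.
move=> h1 h2; have [h3 h4] := dnextP p.
apply: dtail_inj; first by rewrite h3.
have [] := @incident2 (dhead p) p.1 (dnext p).1 q.1; rewrite 1?eq_sym //.
- exact: incident_dhead.
- by rewrite -h3 incident_dtail.
- by rewrite -h1 incident_dtail.
by move=> E; rewrite E eqxx in h2.
Qed.

Lemma dnext_drev p : dnext (drev (dnext p)) = drev p.
Proof.
have [h1 h2] := dnextP p; apply/esym/dnext_uniq; first by rewrite dtail_drev dhead_drev h1.
by rewrite eq_sym.
Qed.

Lemma dnext_inj : injective dnext.
Proof.
move=> p q E; have drevK : involutive drev by case=> e b; rewrite /drev /= negbK.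
by apply: (can_inj drevK); rewrite -(dnext_drev p) -(dnext_drev q) E.
Qed.

Variable p0 : dart.
Definition dstep i := iter i dnext p0.
Definition period := fingraph.order dnext p0.

Lemma period_gt0 : (0 < period)%N. Proof. exact: fingraph.order_gt0. Qed.

Lemma dstepS i : dstep i.+1 = dnext (dstep i). Proof. by []. Qed.

Lemma dstep_period i : dstep (period + i) = dstep i.
Proof. by rewrite addnC /dstep iterD (fingraph.iter_order dnext_inj). Qed.

Lemma dstep_inj i j : (i < period)%N -> (j < period)%N -> dstep i = dstep j -> i = j.
Proof.
by move=> hi hj E; rewrite -(fingraph.findex_iter hi) -(fingraph.findex_iter hj) -/(dstep i) E.
Qed.

Lemma dtail_dstepS i : dtail (dstep i.+1) = dhead (dstep i).
Proof. by have [] := dnextP (dstep i). Qed.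

Lemma dstep_mod i : exists2 j, (j < period)%N & dstep i = dstep j.
Proof.
elim: i => [|i [j hj E]]; first by exists 0%N => //; exact: period_gt0.
rewrite dstepS E -dstepS; move: hj; rewrite leq_eqVlt => /predU1P [->|h]; last by exists j.+1.
by exists 0%N; [exact: period_gt0 | rewrite -(dstep_period 0) addn0].
Qed.

(** If a later dart reversed an earlier one, peeling off one step at each end would give a reversal
    two steps closer, ending with a dart equal to its own reverse or an immediate backtrack. *)
Lemma dstep_rev_lt k i : dstep i <> drev (dstep (i + k)).
Proof.
elim/ltn_ind: k i => -[|[|k]] IH i.
- by rewrite addn0; case: (dstep i) => e [].
- rewrite addn1 dstepS => E; have [_] := dnextP (dstep i).
  by rewrite {2}E /= eqxx.
rewrite addnS dstepS => E; apply: (IH k _ i.+1); first by rewrite ltnW.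
by rewrite dstepS E dnext_drev addSnnS.
Qed.

(* A non-backtracking walk never traverses an edge in both directions. *)
Lemma dstep_rev i j : dstep i <> drev (dstep j).
Proof.
case: (leqP i j) => h; first by rewrite -(subnKC h); exact: dstep_rev_lt.
move=> E; apply: (@dstep_rev_lt (i - j) j); rewrite subnKC ?(ltnW h) // E.
by rewrite /drev /= negbK; case: (dstep j).
Qed.

Lemma dstep_edge_inj i j : (i < period)%N -> (j < period)%N -> (dstep i).1 = (dstep j).1 -> i = j.
Proof.
move=> hi hj; have := @dstep_rev i j; have := dstep_inj hi hj.
case: (dstep i) (dstep j) => [e b] [f b'] /= inj rev E.
case: (eqVneq b b') => bb; first by apply: inj; rewrite E bb.
by case: rev; rewrite /drev /= E; case: b b' bb {inj} => [] [].
Qed.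

(** Adding one period provides a predecessor even for the initial dart. *)
Lemma dstep_pred i : exists j, dstep i = dnext (dstep j).
Proof.
have [k hk] : exists k, (period + i = k.+1)%N.
  by exists (period + i).-1; rewrite prednK // ltn_addr // period_gt0.
by exists k; rewrite -dstepS -hk dstep_period.
Qed.

Lemma dstep_around i e : incident src tgt (dtail (dstep i)) e ->
  e = (dstep i).1 \/ exists2 j, dstep i = dnext (dstep j) & e = (dstep j).1.
Proof.
move=> he; have [j E] := dstep_pred i; have [h1 h2] := dnextP (dstep j).
rewrite E h1 in he *.
have [] := incident2 h2 _ (incident_dhead (dstep j)) he.
- by rewrite -h1 incident_dtail.
- by left.
- by right; exists j.
Qed.

(** The vertices visited by the walk are closed under adjacency, since the two edges at a visited
    vertex are the incoming and the outgoing one; connectedness does the rest. *)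
Lemma dstep_all_vertices v : exists i, dtail (dstep i) = v.
Proof.
have [w hw] : exists w, is_walk (dtail (dstep 0)) v w by case: hg.
elim: w (0%N) hw => [|[e b] w IH] i /=; first by move=> /eqP <-; exists i.
have stp u' : incident src tgt (dtail (dstep i)) e -> incident src tgt u' e -> u' != dtail (dstep i) ->
    exists j, dtail (dstep j) = u'.
  move=> h h' ne'.
  have key (p : dart) : p.1 = e -> incident src tgt u' e -> u' = dtail p \/ u' = dhead p.
    by move=> <-; rewrite /dtail /dhead => /orP [] /eqP <-; case: p.2; (by left) || by right.
  case: (dstep_around h) => [E|[j E1 E2]].
    by case: (key _ (esym E) h') => E'; [rewrite E' eqxx in ne' | exists i.+1; rewrite dtail_dstepS].
  case: (key _ (esym E2) h') => E'; first by exists j.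
  by exfalso; move: ne'; rewrite E1; have [-> _] := dnextP (dstep j); rewrite E' eqxx.
case: b => /andP [/eqP h hw].
  have [j hj] : exists j, dtail (dstep j) = tgt e.
    by apply: stp; rewrite /incident -?h ?eqxx ?orbT // eq_sym loopless.
  by apply: (IH j); rewrite hj.
have [j hj] : exists j, dtail (dstep j) = src e.
  by apply: stp; rewrite /incident -?h ?eqxx ?orbT // loopless.
by apply: (IH j); rewrite hj.
Qed.

Lemma dstep_vertex v : exists2 i, (i < period)%N & dtail (dstep i) = v.
Proof.
by have [i <-] := dstep_all_vertices v; have [j hj ->] := dstep_mod i; exists j.
Qed.

Lemma dstep_edge e : exists2 i, (i < period)%N & (dstep i).1 = e.
Proof.
suff [i hi] : exists i, (dstep i).1 = e by have [j hj E] := dstep_mod i; exists j; rewrite -?E.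
have [i hi] := dstep_all_vertices (src e).
have : incident src tgt (dtail (dstep i)) e by rewrite hi /incident eqxx.
by move=> /dstep_around [->|[j _ ->]]; [exists i | exists j].
Qed.

(** The edge of [dstep j] at the common tail is either that of [dstep i], or the one by which the
    walk arrives there; in the latter case [dstep j] would reverse an earlier dart of the orbit. *)
Lemma dtail_dstep_inj i j : (i < period)%N -> (j < period)%N ->
  dtail (dstep i) = dtail (dstep j) -> i = j.
Proof.
move=> hi hj E; have : incident src tgt (dtail (dstep i)) (dstep j).1 by rewrite E incident_dtail.
move=> /dstep_around [h|[k E1 E2]]; first by apply: dstep_edge_inj.
exfalso; apply: (@dstep_rev j k); apply: dtail_inj => //.
by rewrite dtail_drev -E E1; case: (dnextP (dstep k)).
Qed.

End TwoRegular.

(** * Unrolling a graph of degree 2 onto a circle *)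

Section Circle.
Variables (R : realType) (g : mgraph R).
Hypothesis hg : is_mgraph g.
Local Notation nv := (mg_nv g).
Local Notation ne := (mg_ne g).
Local Notation src := (@mg_src _ g).
Local Notation tgt := (@mg_tgt _ g).
Local Notation len := (@mg_len _ g).
Hypothesis deg2 : forall v, degree src tgt v = 2.
Variable p0 : 'I_ne * bool.
Local Notation dstep := (dstep p0).
Local Notation period := (period p0).
Implicit Types (u v : 'I_nv) (e f : 'I_ne) (x y z : gpt g) (i j k : nat) (s t : R).

Definition step_len i : R := len (dstep i).1.
Definition step_pos i : R := \sum_(j < i) step_len j.
Definition step_pt i t : gpt g := onedge (dstep i).1 (if (dstep i).2 then t else step_len i - t).

Lemma step_len_gt0 i : 0 < step_len i. Proof. exact: len_gt0. Qed.

Lemma step_pos0 : step_pos 0 = 0. Proof. by rewrite /step_pos big_ord0. Qed.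

Lemma step_posS i : step_pos i.+1 = step_pos i + step_len i.
Proof. by rewrite /step_pos big_ord_recr. Qed.

Lemma step_pos_le i j : (i <= j)%N -> step_pos i <= step_pos j.
Proof.
move=> /subnKC <-; elim: (j - i)%N => [|k IH]; first by rewrite addn0.
by rewrite addnS step_posS; apply: le_trans IH _; rewrite lerDl ltW ?step_len_gt0.
Qed.

Lemma step_pos_ge0 i : 0 <= step_pos i. Proof. by rewrite -step_pos0 step_pos_le. Qed.

Lemma step_len_period i : step_len (period + i) = step_len i.
Proof. by rewrite /step_len dstep_period. Qed.

Lemma step_pos_period i : step_pos (period + i) = step_pos period + step_pos i.
Proof.
elim: i => [|i IH]; first by rewrite addn0 step_pos0 addr0.
by rewrite addnS !step_posS IH step_len_period addrA.
Qed.

Lemma step_pt_period i t : step_pt (period + i) t = step_pt i t.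
Proof. by rewrite /step_pt /step_len dstep_period. Qed.

Lemma valid_step_pt i t : valid (step_pt i t). Proof. exact: valid_onedge. Qed.

Lemma step_pt0 i : step_pt i 0 = GV (dtail (dstep i)).
Proof.
rewrite /step_pt /dtail /step_len; case: (dstep i) => e [] /=; first by rewrite onedge0.
by rewrite subr0 onedge_len.
Qed.

Lemma step_pt_len i : step_pt i (step_len i) = step_pt i.+1 0.
Proof.
rewrite step_pt0 (dtail_dstepS deg2) /step_pt /dhead /step_len; case: (dstep i) => e [] /=.
  by rewrite onedge_len.
by rewrite subrr onedge0.
Qed.

Lemma step_pt_in i t : 0 < t < step_len i ->
  step_pt i t = GE (dstep i).1 (if (dstep i).2 then t else step_len i - t).
Proof.
by move=> /andP [t0 t1]; rewrite /step_pt onedge_in // -/(step_len i); case: ifP => _; apply/andP; split; lra.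
Qed.

Lemma step_pt_dist i s t : 0 <= s <= step_len i -> 0 <= t <= step_len i -> gdist (step_pt i s) (step_pt i t) <= `|s - t|.
Proof.
move=> /andP [s0 s1] /andP [t0 t1]; rewrite /step_pt; case: ifP => _.
  by apply: gdist_onedge => //; apply/andP.
have -> : `|s - t| = `|(step_len i - s) - (step_len i - t)| by rewrite distrC; congr (`|_|); lra.
by apply: gdist_onedge => //; apply/andP; rewrite -/(step_len i); split; lra.
Qed.

Lemma step_pt_walk i s k : 0 <= s <= step_len i ->
  gdist (step_pt i s) (step_pt (i + k.+1) 0) <= step_pos (i + k.+1) - (step_pos i + s).
Proof.
move=> /[dup] hs /andP [s0 s1]; have l0 := ltW (step_len_gt0 i).
elim: k => [|k IH].
  rewrite addn1 -step_pt_len step_posS; apply: le_trans (step_pt_dist hs _) _; first by rewrite l0 lexx.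
  by rewrite distrC ger0_norm ?subr_ge0 //; lra.
have lk := ltW (step_len_gt0 (i + k.+1)).
rewrite addnS -step_pt_len step_posS.
have := gdist_tri hg (valid_step_pt i s) (valid_step_pt (i + k.+1) 0) (valid_step_pt (i + k.+1) (step_len (i + k.+1))).
have := @step_pt_dist (i + k.+1) 0 (step_len (i + k.+1)).
rewrite !lexx lk sub0r normrN ger0_norm // => /(_ isT isT); lra.
Qed.

Lemma step_pt_forward i s j t : 0 <= s <= step_len i -> 0 <= t <= step_len j ->
  (i < j)%N \/ i = j /\ s <= t -> gdist (step_pt i s) (step_pt j t) <= (step_pos j + t) - (step_pos i + s).
Proof.
move=> hs ht [ij|[ij st]]; last first.
  rewrite -ij in ht *.
  by apply: le_trans (step_pt_dist hs ht) _; rewrite distrC ger0_norm ?subr_ge0 //; lra.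
rewrite -(subnKC ij) addSnnS in ht *; set k := (j - i.+1)%N in ht *.
have := gdist_tri hg (valid_step_pt i s) (valid_step_pt (i + k.+1) 0) (valid_step_pt (i + k.+1) t).
have := step_pt_walk k hs; have := @step_pt_dist (i + k.+1) 0 t.
have lk := ltW (step_len_gt0 (i + k.+1)); have /andP [t0 _] := ht.
rewrite ht lexx lk sub0r normrN ger0_norm // => /(_ isT isT); lra.
Qed.

Lemma step_pt_ex x : valid x -> exists i t, [/\ (i < period)%N, 0 <= t < step_len i & x = step_pt i t].
Proof.
case: x => [v _|e t /= /andP [t0 t1]].
  have [i hi <-] := dstep_vertex hg deg2 p0 v.
  by exists i, 0; rewrite lexx step_len_gt0 step_pt0.
have [i hi E] := dstep_edge hg deg2 p0 e.
exists i, (if (dstep i).2 then t else len e - t).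
have ht : 0 < (if (dstep i).2 then t else len e - t) < step_len i.
  by rewrite /step_len E; case: ifP => _; apply/andP; split; lra.
split=> //; first by case/andP: ht => /ltW -> ->.
rewrite step_pt_in // /step_len E; case: (dstep i).2 => //; congr GE; lra.
Qed.

Lemma step_pt_inj i s j t : (i < period)%N -> (j < period)%N -> 0 <= s < step_len i -> 0 <= t < step_len j ->
  step_pt i s = step_pt j t -> i = j /\ s = t.
Proof.
move=> hi hj /andP [s0 s1] /andP [t0 t1].
move: s0 t0; rewrite !le_eqVlt => /predU1P [<-|s0] /predU1P [<-|t0].
- by rewrite !step_pt0 => -[] /(dtail_dstep_inj hg deg2 hi hj).
- by rewrite step_pt0 step_pt_in ?t0.
- by rewrite step_pt0 step_pt_in ?s0.
rewrite !step_pt_in ?s0 ?t0 // => -[] /(dstep_edge_inj hg deg2 hi hj) E; rewrite -E.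
by case: ifP => _ h; split=> //; lra.
Qed.

(** Arclength from the start of the closed walk. The relation is single-valued by [step_pt_inj], and
    the default 0 is irrelevant at valid points by [step_pt_ex]. *)
Definition circ_pos x : R :=
  xget 0 [set r | exists i t, [/\ (i < period)%N, 0 <= t < step_len i, x = step_pt i t & r = step_pos i + t]].

Lemma circ_posE i t : (i < period)%N -> 0 <= t < step_len i -> circ_pos (step_pt i t) = step_pos i + t.
Proof.
move=> hi ht; rewrite /circ_pos; case: xgetP => [r -> [j [s [hj hs E ->]]]|/(_ (step_pos i + t))].
  by have [<- <-] := step_pt_inj hi hj ht hs E.
by case; exists i, t.
Qed.

Lemma circ_pos_range x : valid x -> 0 <= circ_pos x < step_pos period.
Proof.
move=> /step_pt_ex [i [t [hi ht ->]]]; rewrite circ_posE //; have /andP [t0 t1] := ht.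
rewrite addr_ge0 ?step_pos_ge0 //= (@lt_le_trans _ _ (step_pos i.+1)) ?step_pos_le //.
by rewrite step_posS ltrD2l.
Qed.

Lemma circ_pos_inj x y : valid x -> valid y -> circ_pos x = circ_pos y -> x = y.
Proof.
move=> /step_pt_ex [i [s [hi hs ->]]] /step_pt_ex [j [t [hj ht ->]]].
rewrite !circ_posE // => E; have /andP [s0 s1] := hs; have /andP [t0 t1] := ht.
case: (ltngtP i j) => ij.
- by exfalso; move: (step_pos_le ij); rewrite step_posS; lra.
- by exfalso; move: (step_pos_le ij); rewrite step_posS; lra.
by rewrite -ij in E *; congr step_pt; lra.
Qed.

Lemma step_pos_interval k s : 0 <= s < step_pos k -> exists i, (i < k)%N /\ step_pos i <= s < step_pos i.+1.
Proof.
elim: k => [|k IH]; first by rewrite step_pos0 => h; exfalso; lra.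
move=> /andP [s0 s1]; case: (ltP s (step_pos k)) => h; last by exists k; rewrite ltnS leqnn h s1.
by have [|i [hi hs]] := IH; [rewrite s0 | exists i; rewrite ltnS ltnW].
Qed.

Lemma circ_pos_surj s : 0 <= s < step_pos period -> exists x, valid x /\ circ_pos x = s.
Proof.
move=> /step_pos_interval [i [hi /andP [h1]]]; rewrite step_posS => h2.
exists (step_pt i (s - step_pos i)); split; first exact: valid_step_pt.
by rewrite circ_posE //; [lra | apply/andP; split; lra].
Qed.

Lemma gdist_le_circ_dist x y : valid x -> valid y ->
  gdist x y <= circ_dist (step_pos period) (circ_pos x) (circ_pos y).
Proof.
wlog h : x y / circ_pos x <= circ_pos y.
  move=> W vx vy; case: (leP (circ_pos x) (circ_pos y)) => [|/ltW] h; first exact: W.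
  by rewrite gdistC circ_distC W.
move=> vx vy; move: h.
have [i [s [hi /[dup] hs /andP [s0 s1] ->]]] := step_pt_ex vx.
have [j [t [hj /[dup] ht /andP [t0 t1] ->]]] := step_pt_ex vy.
rewrite !circ_posE // => h.
have hs' : 0 <= s <= step_len i by rewrite s0 ltW.
have ht' : 0 <= t <= step_len j by rewrite t0 ltW.
rewrite /circ_dist distrC ger0_norm ?subr_ge0 // le_min; apply/andP; split.
  apply: step_pt_forward => //; case: (ltngtP i j) => ij; first by left.
    by exfalso; move: (step_pos_le ij); rewrite step_posS; lra.
  by right; split=> //; move: h; rewrite ij; lra.
(* The complementary arc runs forward from the second point to the copy of the first one period
   later. *)
rewrite gdistC -(step_pt_period i); apply: le_trans (@step_pt_forward _ _ _ _ ht' _ _) _.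
- by rewrite step_len_period.
- by left; rewrite ltn_addr.
by rewrite step_pos_period; lra.
Qed.

(** The second alternative is the wrap-around: the end of the last step is the starting point, whose
    position is 0 and not the circumference. *)
Lemma circ_pos_loc x e s : valid x -> loc x e s -> forall i, (i < period)%N -> (dstep i).1 = e ->
  let t := if (dstep i).2 then s else step_len i - s in
  circ_pos x = step_pos i + t \/ circ_pos x = 0 /\ step_pos i + t = step_pos period.
Proof.
move=> vx hl i hi E t; have /andP [s0 s1] := loc_le hg vx hl.
have Ex : x = step_pt i t.
  have -> : step_pt i t = onedge e s.
    by rewrite /step_pt E /t; case: (dstep i).2 => //; congr onedge; lra.
  case: x vx hl => [v _ [] [-> ->]|f q vt [<- ->]].
  - by rewrite onedge0.
  - by rewrite onedge_len.
  - by rewrite onedge_in.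
have t0 : 0 <= t by rewrite /t /step_len E; case: ifP => // _; lra.
have : t <= step_len i by rewrite /t /step_len E; case: ifP => // _; lra.
rewrite le_eqVlt => /predU1P [te|t1]; last by left; rewrite Ex circ_posE // t0.
move: hi; rewrite leq_eqVlt => /predU1P [h|h].
  right; rewrite Ex te step_pt_len -step_posS h; split=> //.
  rewrite -[X in step_pt X]addn0 step_pt_period circ_posE ?period_gt0 ?lexx ?step_len_gt0 //.
  by rewrite step_pos0 addr0.
by left; rewrite Ex te step_pt_len circ_posE ?lexx ?step_len_gt0 // addr0 step_posS.
Qed.

(** The circle distance, pulled back by [circ_pos], is dominated by arclength on each edge, so
    [gdist_maximal] bounds it. *)
Lemma circ_dist_le_gdist x y : valid x -> valid y ->
  circ_dist (step_pos period) (circ_pos x) (circ_pos y) <= gdist x y.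
Proof.
move: x y; apply: (gdist_maximal hg (D := fun x y => circ_dist (step_pos period) (circ_pos x) (circ_pos y))).
- by move=> x vx; rewrite /circ_dist subrr normr0 ge_min lexx.
- by move=> x y z vx vy vz; apply: circ_dist_tri; exact: circ_pos_range.
move=> x y e s t vx vy hs ht; have [i hi E] := dstep_edge hg deg2 p0 e.
have := circ_pos_range vx; have := circ_pos_range vy.
have hx := circ_pos_loc vx hs hi E; have hy := circ_pos_loc vy ht hi E.
have -> : `|s - t| = `|(if (dstep i).2 then s else step_len i - s) - (if (dstep i).2 then t else step_len i - t)|.
  by case: ifP => // _; rewrite distrC; congr (`|_|); lra.
move: (if _ then s else _) (if _ then t else _) hx hy => u w /= hx hy.
rewrite /circ_dist => /andP [y0 y1] /andP [x0 x1]; rewrite ge_min; apply/orP.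
case: hx => [->|[-> Ex]]; case: hy => [Ey|[Ey Ey']].
- by left; rewrite Ey le_eqVlt; apply/orP; left; apply/eqP; congr (`|_|); lra.
- by right; rewrite Ey subr0; move: (ler_norm (w - u)) (ler_norm (step_pos i + u)); rewrite (distrC w u); lra.
- by right; rewrite Ey sub0r normrN; move: (ler_norm (u - w)) (ler_norm (step_pos i + w)); lra.
- by left; rewrite Ey subrr normr0.
Qed.

Lemma reindex_step (T : Type) (idx : T) (op : Monoid.com_law idx) (F : 'I_ne -> T) :
  \big[op/idx]_e F e = \big[op/idx]_(i < period) F (dstep i).1.
Proof.
have inv e : exists i : 'I_period, (dstep i).1 = e.
  by have [i hi E] := dstep_edge hg deg2 p0 e; exists (Ordinal hi).
pose h e := projT1 (cid (inv e)).
have hK e : (dstep (h e)).1 = e by rewrite /h; case: cid.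
rewrite (reindex (fun i : 'I_period => (dstep i).1)) //=.
exists h => [i _|e _]; last exact: hK.
by apply/val_inj; apply: (dstep_edge_inj hg deg2 (p0 := p0)) => //=; rewrite hK.
Qed.

Lemma total_len_step_pos : total_len g = step_pos period.
Proof. by rewrite /total_len reindex_step. Qed.

(** On one edge [circ_pos] is a translation or a reflection, according to the direction in which the
    walk traverses it. *)
Lemma lebesgue_circ_pos_slice (B : set R) i : measurable B -> (i < period)%N ->
  lebesgue_measure (edge_slice (circ_pos @^-1` B) (dstep i).1) =
  lebesgue_measure (B `&` `]step_pos i, step_pos i.+1[).
Proof.
move=> mB hi; have mI : measurable (B `&` `]step_pos i, step_pos i.+1[).
  by apply: measurableI => //; exact: measurable_itv.
have E t : 0 < t < step_len i ->
    circ_pos (GE (dstep i).1 t) = step_pos i + (if (dstep i).2 then t else step_len i - t).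
  move=> /andP [t0 t1]; rewrite -circ_posE //; last first.
    by case: ifP => _; apply/andP; split; lra.
  rewrite step_pt_in; last by case: ifP => _; apply/andP; split; lra.
  by case: (dstep i).2 => //; congr (circ_pos (GE _ _)); lra.
move: E; case: (dstep i).2 => E.
  rewrite -(lebesgue_shift (step_pos i) mI); congr lebesgue_measure.
  apply/seteqP; split=> t /=.
    by move=> [ht]; rewrite /preimage /= E // in_itv /= step_posS => ?; split=> //; move: ht; rewrite -/(step_len i); lra.
  move=> [hB]; rewrite in_itv /= step_posS => ht; have ht' : 0 < t < step_len i by lra.
  by split=> //; rewrite /preimage /= E.
rewrite -(lebesgue_reflection (step_pos i + step_len i) mI); congr lebesgue_measure.
apply/seteqP; split=> t /=.
  move=> [ht]; rewrite /preimage /= E // in_itv /= step_posS addrA => ?; split=> //.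
  by move: ht; rewrite -/(step_len i); lra.
move=> [hB]; rewrite in_itv /= step_posS => ht; have ht' : 0 < t < step_len i by lra.
by split=> //; rewrite /preimage /= E // addrA.
Qed.

(** The open arcs of the edges miss only the positions of the vertices, each of measure 0, which is
    why open intervals add up to a half-open one. *)
Lemma lebesgue_step_pos_split (B : set R) k : measurable B ->
  (\sum_(i < k) lebesgue_measure (B `&` `]step_pos i, step_pos i.+1[) =
   lebesgue_measure (B `&` `[(0 : R)%R, step_pos k[))%E.
Proof.
move=> mB; elim: k => [|k IH].
  by rewrite big_ord0 step_pos0 set_itvco0 setI0 measure0.
rewrite big_ord_recr /= IH.
have mI (J : interval R) : measurable (B `&` [set` J]) by apply: measurableI => //; exact: measurable_itv.
have E1 : lebesgue_measure (B `&` `[step_pos k, step_pos k.+1[) = lebesgue_measure (B `&` `]step_pos k, step_pos k.+1[).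
  apply/eqP; rewrite eq_le; apply/andP; split; last first.
    apply: le_lebesgue => t /= [hB]; rewrite !in_itv /= => /andP [/ltW h1 h2]; split=> //; exact/andP.
  apply: (@le_trans _ _ (lebesgue_measure ([set step_pos k] `|` (B `&` `]step_pos k, step_pos k.+1[)))).
    apply: le_lebesgue => t /= [hB]; rewrite !in_itv /= le_eqVlt => /andP [/orP [/eqP <-|h1] h2]; [left|right] => //.
    by split=> //; apply/andP.
  rewrite -[leRHS]add0e -(lebesgue_measure_set1 (step_pos k)).
  exact: (outer_measureU2 ((wlength idfun)^*)%mu).
rewrite -E1; apply/esym.
have -> : B `&` `[0, step_pos k.+1[ = (B `&` `[0, step_pos k[) `|` (B `&` `[step_pos k, step_pos k.+1[).
  rewrite -setIUr; congr (_ `&` _); apply/seteqP; split=> t /=; rewrite !in_itv /= step_posS.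
    by move=> /andP [h1 h2]; case: (ltP t (step_pos k)) => h; [left|right]; apply/andP.
  by move: (step_pos_ge0 k) (step_len_gt0 k) => ? ? [] /andP [? ?]; apply/andP; split; lra.
apply: measureU; [exact: mI | exact: mI |].
by apply/seteqP; split=> t //= -[[_]]; rewrite !in_itv /= => /andP [_ h1] [_ /andP [h2 _]]; move: (lt_le_trans h1 h2); rewrite ltxx.
Qed.

Lemma circle_of_step : is_circle_graph g.
Proof.
exists (step_pos period); split; first by rewrite -total_len_step_pos total_len_gt0.
exists circ_pos; split.
- exact: circ_pos_range.
- exact: circ_pos_inj.
- exact: circ_pos_surj.
- by move=> x y vx vy; apply/eqP; rewrite eq_le circ_dist_le_gdist ?gdist_le_circ_dist.
move=> B mB; rewrite /mg_measure /circ_measure total_len_step_pos; congr (_ * _)%E.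
rewrite reindex_step -lebesgue_step_pos_split //; apply: eq_bigr => i _.
exact: lebesgue_circ_pos_slice.
Qed.

End Circle.

Lemma circle_of_two_regular (R : realType) (g : mgraph R) : is_mgraph g ->
  (forall v, degree (@mg_src _ g) (@mg_tgt _ g) v = 2) -> is_circle_graph g.
Proof.
move=> hg deg2; have [ne0 _ _ _ _] := hg.
exact: (circle_of_step hg deg2 (Ordinal ne0, true)).
Qed.

Theorem theorem6p1 (R : realType) (G H : mgraph R)
    (hG : is_mgraph G) (hH : is_mgraph H)
    (notcirc : ~ is_circle_graph G)
    (phi : gpt G -> gpt H)
    (phi_into : forall x, valid x -> valid (phi x))
    (phi_cont : forall x, valid x -> forall eps : R, 0 < eps ->
        exists2 delta : R, 0 < delta &
          forall y, valid y -> gdist x y < delta -> gdist (phi x) (phi y) < eps)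
    (phi_push : forall B, mg_measurable B -> mg_measure (phi @^-1` B) = mg_measure B)
    (phi_h : forall x, valid x -> forall r : R, 0 <= r -> hdist x r = hdist (phi x) r) :
  mm_iso phi.
Proof.
case: (pselect (exists v, @node R G v)) => [[v nv]|nonode].
  exact: (mm_iso_of_node hG hH phi_into phi_cont phi_push phi_h nv).
case: notcirc; apply: circle_of_two_regular => // v.
by apply/eqP; apply: contrapT => hv; apply: nonode; exists v; apply/negP.
Qed.
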